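(* Let $a>b>0$, let $\mathcal{E}:\ \frac{\mathsf{x}^2}{a}+\frac{\mathsf{y}^2}{b}=1$, and let $\mathcal{C}_{\lambda_0}$, $\lambda_0\in(0,b)\cup(b,a)$, be a conic confocal with $\mathcal{E}$. Let $n$ be a positive integer. A billiard trajectory within $\mathcal{E}$ with caustic $\mathcal{C}_{\lambda_0}$ is $n$-elliptic periodic without being $n$-periodic if and only if one of the following conditions is satisfied on the elliptic curve $\mathscr{C}:\ y^2=(a-x)(b-x)(\lambda_0-x)$: (a) $\mathcal{C}_{\lambda_0}$ is an ellipse and $n(Q_0-Q_{\lambda_0})+Q_b-Q_a\sim 0$; (b) $\mathcal{C}_{\lambda_0}$ is a hyperbola and $n(Q_0-Q_b)+Q_{\lambda_0}-Q_a\sim 0$; (c) $\mathcal{C}_{\lambda_0}$ is a hyperbola, $n$ is odd, and $n(Q_0-Q_b)\sim 0$. Moreover, such trajectories are always symmetric with respect to the origin in Case (a) and, when $n$ is odd, in Case (b). They are symmetric with respect to the smaller axis of $\mathcal{E}$ (the $\mathsf{y}$-axis) in Case (b) for even $n$, and with respect to the larger axis of $\mathcal{E}$ (the $\mathsf{x}$-axis) in Case (c).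
   Context: The confocal family is $\mathcal{C}_{\lambda}:\ \frac{\mathsf{x}^2}{a-\lambda}+\frac{\mathsf{y}^2}{b-\lambda}=1$; $\mathcal{C}_\lambda$ is an ellipse for $\lambda<b$, a hyperbola for $\lambda\in(b,a)$, with degenerate members the $\mathsf{x}$-axis ($\lambda=b$) and the $\mathsf{y}$-axis ($\lambda=a$). Billiard trajectories within $\mathcal{E}$ are polygonal lines with vertices on $\mathcal{E}$ obeying the reflection law at each vertex; a trajectory has caustic $\mathcal{C}_{\lambda_0}$ if all lines containing its segments are tangent to $\mathcal{C}_{\lambda_0}$. A trajectory is $n$-periodic if it closes after $n$ reflections ($n$ not required to be minimal). Every point other than the foci lies on exactly two conics $\mathcal{C}_{\lambda_1},\mathcal{C}_{\lambda_2}$, $\lambda_1<\lambda_2$; $(\lambda_1,\lambda_2)$ are its elliptic coordinates. A trajectory is $n$-elliptic periodic if it is $n$-periodic in elliptic coordinates, i.e. the elliptic coordinates of the moving point along the trajectory repeat periodically after $n$ reflections. On $\mathscr{C}$, $Q_0$ is a point with $x=0$, and $Q_a,Q_b,Q_{\lambda_0}$ are the points with $x=a,b,\lambda_0$; $\sim$ is linear equivalence of divisors on the projective completion of $\mathscr{C}$. *)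

(* Defs.v *)
From HB Require Import structures.
From mathcomp Require Import all_boot all_order all_algebra.
From mathcomp Require Import reals complex freeg mpoly.

Set Implicit Arguments.
Unset Strict Implicit.
Unset Printing Implicit Defensive.

Import Order.TTheory GRing.Theory Num.Theory.
Local Open Scope ring_scope.

(** ** The confocal family *)

(* The conic C_lam of the confocal family; the members lam = b and lam = a are *)
(* the x-axis and the y-axis.  The boundary of the billiard table is C_0.      *)
Definition on_conic (R : realType) (a b lam : R) (p : R * R) : Prop :=
  if lam == b then p.2 = 0
  else if lam == a then p.1 = 0
  else p.1 ^+ 2 / (a - lam) + p.2 ^+ 2 / (b - lam) = 1.

Definition is_ellipse (R : realType) (b lam : R) : Prop := lam < b.
Definition is_hyperbola (R : realType) (a b lam : R) : Prop := b < lam < a.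

(* A relation rather than a function, since the foci have no elliptic          *)
(* coordinates; any other point has exactly one pair l.                        *)
Definition elliptic_coords (R : realType) (a b : R) (p l : R * R) : Prop :=
  [/\ l.1 < l.2, on_conic a b l.1 p & on_conic a b l.2 p].

(* The line through the distinct points p and q is the tangent line of C_lam   *)
(* (lam <> a, b) at the point (X : Y : Z) of its projective closure.  Points   *)
(* with Z = 0 occur for hyperbolas only; there the tangents are the asymptotes.*)
Definition tangent_to_conic (R : realType) (a b lam : R) (p q : R * R) : Prop :=
  exists X Y Z : R,
    [/\ (X, Y, Z) != (0, 0, 0),
        X ^+ 2 / (a - lam) + Y ^+ 2 / (b - lam) = Z ^+ 2,
        X * p.1 / (a - lam) + Y * p.2 / (b - lam) = Z
      & X * q.1 / (a - lam) + Y * q.2 / (b - lam) = Z].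

(** ** Billiard trajectories *)

Definition dot (R : realType) (u v : R * R) : R := u.1 * v.1 + u.2 * v.2.

Definition unit_dir (R : realType) (p q : R * R) : R * R :=
  let d := (q.1 - p.1, q.2 - p.2) in
  (d.1 / Num.sqrt (dot d d), d.2 / Num.sqrt (dot d d)).

(* Mirror image of the vector u in the line orthogonal to N. *)
Definition mirror (R : realType) (N u : R * R) : R * R :=
  let k := 2 * dot u N / dot N N in (u.1 - k * N.1, u.2 - k * N.2).

(* (q.1 / a, q.2 / b) is normal to the ellipse C_0 at its point q. *)
Definition reflection_law (R : realType) (a b : R) (p q r : R * R) : Prop :=
  unit_dir q r = mirror (q.1 / a, q.2 / b) (unit_dir p q).

(* A trajectory is given by the bi-infinite sequence of its vertices. *)
Definition billiard_trajectory (R : realType) (a b : R) (v : int -> R * R) :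
    Prop :=
  forall i : int,
    [/\ on_conic a b 0 (v i), v i != v (i + 1)
      & reflection_law a b (v (i - 1)) (v i) (v (i + 1))].

Definition has_caustic (R : realType) (a b lam : R) (v : int -> R * R) : Prop :=
  forall i : int, tangent_to_conic a b lam (v i) (v (i + 1)).

(* Position of the moving point on the segment [v i, v (i + 1)]; s runs        *)
(* from 0 to 1.                                                                *)
Definition moving_point (R : realType) (v : int -> R * R) (i : int) (s : R) :
    R * R :=
  ((1 - s) * (v i).1 + s * (v (i + 1)).1,
   (1 - s) * (v i).2 + s * (v (i + 1)).2).

Definition n_periodic (R : realType) (n : nat) (v : int -> R * R) : Prop :=
  forall i : int, v (i + n%:Z) = v i.

Definition n_elliptic_periodic (R : realType) (a b : R) (n : nat)
    (v : int -> R * R) : Prop :=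
  forall (i : int) (s : R), 0 <= s <= 1 -> forall l : R * R,
    elliptic_coords a b (moving_point v (i + n%:Z) s) l <->
    elliptic_coords a b (moving_point v i s) l.

Definition on_trajectory (R : realType) (v : int -> R * R) (p : R * R) : Prop :=
  exists (i : int) (s : R), 0 <= s <= 1 /\ p = moving_point v i s.

Definition symmetric_under (R : realType) (sigma : R * R -> R * R)
    (v : int -> R * R) : Prop :=
  forall p : R * R, on_trajectory v p <-> on_trajectory v (sigma p).

Definition central_sym (R : realType) (p : R * R) : R * R := (- p.1, - p.2).
Definition x_axis_sym (R : realType) (p : R * R) : R * R := (p.1, - p.2).
Definition y_axis_sym (R : realType) (p : R * R) : R * R := (- p.1, p.2).

(** ** Linear equivalence on y^2 = (a - x)(b - x)(c - x) *)

(* Some (x, y) is the affine point (x : y : 1) and None is (0 : 1 : 0), the    *)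
(* only point of the projective completion of the curve on the line Z = 0.     *)
Definition ppoint (F : closedFieldType) : Type := option (F * F).
HB.instance Definition _ (F : closedFieldType) := Choice.on (ppoint F).

Definition hcoords (F : closedFieldType) (P : ppoint F) : 'I_3 -> F :=
  match P with
  | Some (x, y) => tnth [tuple x; y; 1]
  | None => tnth [tuple 0; 1; 0]
  end.

(* X = 'X_0, Y = 'X_1, Z = 'X_2 *)
Definition cubic (F : closedFieldType) (a b c : F) : {mpoly F[3]} :=
  'X_1 ^+ 2 * 'X_2
  - (a *: 'X_2 - 'X_0) * (b *: 'X_2 - 'X_0) * (c *: 'X_2 - 'X_0).

Definition on_curve (F : closedFieldType) (a b c : F) (P : ppoint F) : Prop :=
  (cubic a b c).@[hcoords P] = 0.

(* A linear form whose zero line passes through P and is not the tangent of    *)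
(* the curve at P, i.e. a local parameter at P up to a unit.                   *)
Definition local_param (F : closedFieldType) (P : ppoint F) : {mpoly F[3]} :=
  match P with
  | Some (x, y) => if y == 0 then 'X_1 else 'X_0 - x *: 'X_2
  | None => 'X_0
  end.

(* The form G of degree d vanishes to order k at P along the curve: G = t^k    *)
(* U / V on the curve, with t the local parameter and U, V forms not vanishing *)
(* at P.  The degree equation makes both sides forms of the same degree, so    *)
(* that comparing them at the chosen homogeneous coordinates is meaningful.    *)
(* As F is algebraically closed, agreeing at all points of the curve amounts   *)
(* to congruence modulo the cubic.                                             *)
Definition vanishing_order (F : closedFieldType) (a b c : F) (d : nat)
    (G : {mpoly F[3]}) (P : ppoint F) (k : nat) : Prop :=
  exists (e f : nat) (U V : {mpoly F[3]}),
    [/\ U \is e.-homog /\ U.@[hcoords P] != 0,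
        V \is f.-homog /\ V.@[hcoords P] != 0,
        (f + d = k + e)%N
      & forall Q : ppoint F, on_curve a b c Q ->
          (V * G).@[hcoords Q] = (local_param P ^+ k * U).@[hcoords Q]].

Definition divisor (F : closedFieldType) := {freeg (ppoint F) / int}.

Definition dpoint (F : closedFieldType) (P : ppoint F) : divisor F := << P >>.

(* For divisors supported on the curve: D1 - D2 is the divisor of the rational *)
(* function G / H, a quotient of forms of the same degree.  Vanishing orders   *)
(* being finite, G and H are not identically zero on the curve.                *)
Definition linear_equiv (F : closedFieldType) (a b c : F) (D1 D2 : divisor F) :
    Prop :=
  exists (d : nat) (G H : {mpoly F[3]}),
    [/\ G \is d.-homog, H \is d.-homog
      & forall P : ppoint F, on_curve a b c P ->
          exists k l : nat,
            [/\ vanishing_order a b c d G P k, vanishing_order a b c d H P l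
              & coeff P (D1 - D2) = k%:Z - l%:Z]].

Definition curve_point_over (F : closedFieldType) (a b c x : F) (Q : ppoint F) :
    Prop :=
  on_curve a b c Q /\ exists y : F, Q = Some (x, y).

(* Main.v *)
Require Import Defs.
From HB Require Import structures.
From mathcomp Require Import all_boot all_order all_algebra.
From mathcomp Require Import reals complex freeg mpoly.
From mathcomp Require Import ring lra zify.

Set Implicit Arguments.
Unset Strict Implicit.
Unset Printing Implicit Defensive.

Import Order.TTheory GRing.Theory Num.Theory.
Local Open Scope ring_scope.
Local Open Scope complex_scope.

(* Elliptic coordinates determine a point up to the symmetries of the ellipse, so
   n-elliptic periodicity means that v (i + n) = s (v i) for one symmetry s.
   A vertex with a side, whose second elliptic coordinate is l, is recorded by
   square roots of a - l, b - l and c - l, that is, by a point of the cubic whose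
   double has abscissa l.  Up to the central symmetry, which is the translation
   by (c, 0), the billiard map becomes the translation by Q0; this is a line
   meeting the cubic in three explicit points.  Hence n (Q0 - O) is equivalent to
   the difference of the points of v n and v 0, and the three symmetries are the
   translations by the points of order two.  Distinct points P and Q are not
   equivalent: a function with divisor P + Q' - 2 O, where Q' is the conjugate
   of Q, is a polynomial A(x) + B(x) y of pole order 2, hence a multiple of x - r.
   That the caustic is an ellipse or a hyperbola restricts s: in the first case
   the side keeps the sense of rotation, in the second every side crosses the
   x-axis. *)

(** * Principal divisors on the cubic *)

(** The point of the cubic over [l] itself would be too coarse: the four symmetric copies of a
    vertex share [l], and one reflection moves that point by twice [Q0]. Halving separates the
    copies. A symmetry with signs [e1], [e2] multiplies the three roots by [e1], [e2] and [e1 * e2],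
    since it multiplies slopes by [e1 * e2]; the product of the roots, hence the doubled point, is
    preserved. The parity of [n] enters because the step is a translation by [Q0] only after a
    central symmetry, so the signs of [v n] are read after multiplication by [(-1) ^+ n].
    Translations are written as principal divisors of lines. The main obstacle is to show that a
    point is determined by its class, starting from quotients of forms and local equations: forms
    are restricted to pairs of polynomials, and degrees of norms count their zeros. *)

Lemma mevalXn n (R : comNzRingType) (v : 'I_n -> R) (p : {mpoly R[n]}) k :
  (p ^+ k).@[v] = p.@[v] ^+ k.
Proof. exact: rmorphXn. Qed.

Section Forms.
Variable F : closedFieldType.

Lemma hcoords_affine (x y : F) :
  (hcoords (Some (x, y)) 0 = x) * (hcoords (Some (x, y)) 1 = y)
  * (hcoords (Some (x, y)) 2 = 1 :> F).
Proof. by []. Qed.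

Lemma hcoords_infinity :
  (@hcoords F None 0 = 0) * (@hcoords F None 1 = 1) * (@hcoords F None 2 = 0).
Proof. by []. Qed.

Definition mevals v := (@mevalXn 3 F v, @mevalM 3 F v, @mevalD 3 F v,
  @mevalB 3 F v, @mevalN 3 F v, @mevalZ 3 F v, @mevalXU 3 F v, @mevalC 3 F v,
  @meval1 3 F v, hcoords_affine, hcoords_infinity).

Lemma homogX (i : 'I_3) : ('X_i : {mpoly F[3]}) \is 1.-homog.
Proof. by rewrite dhomogX /= mdeg1. Qed.
End Forms.

Ltac prove_homog :=
  first [ exact: homogX
        | apply: rpredB; prove_homog | apply: rpredD; prove_homog
        | rewrite rpredN; prove_homog | apply: dhomogZ; prove_homog
        | apply: (@dhomogM _ _ _ 1 _ 1); prove_homog ].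

Section Curve.
Variables (F : closedFieldType) (a b c : F).

Definition cubic_at x := (a - x) * (b - x) * (c - x).

Lemma on_curve_affine x y :
  on_curve a b c (Some (x, y)) <-> y ^+ 2 = cubic_at x.
Proof.
rewrite /on_curve /cubic /cubic_at !mevals !mulr1 /=.
by split=> [/eqP|->]; [rewrite subr_eq0 => /eqP|rewrite subrr].
Qed.

Lemma on_curve_infinity : on_curve a b c None.
Proof. by rewrite /on_curve /cubic !mevals; ring. Qed.

Notation order := (vanishing_order a b c).

Lemma vanishing_order0 d (G : {mpoly F[3]}) P :
  G \is d.-homog -> G.@[hcoords P] != 0 -> order d G P 0.
Proof.
move=> hG GP; exists d, 0%N, G, 1; split=> //.
by rewrite dhomog1 meval1 oner_neq0.
Qed.

Lemma vanishing_orderM d1 d2 (G1 G2 : {mpoly F[3]}) P k1 k2 :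
  order d1 G1 P k1 -> order d2 G2 P k2 ->
  order (d1 + d2) (G1 * G2) P (k1 + k2).
Proof.
move=> [e1 [f1 [U1 [V1 [[hU1 nU1] [hV1 nV1] deg1 eq1]]]]].
move=> [e2 [f2 [U2 [V2 [[hU2 nU2] [hV2 nV2] deg2 eq2]]]]].
exists (e1 + e2)%N, (f1 + f2)%N, (U1 * U2), (V1 * V2); split.
- by rewrite dhomogM // mevalM mulf_neq0.
- by rewrite dhomogM // mevalM mulf_neq0.
- by rewrite addnACA deg1 deg2 addnACA.
- move=> Q hQ; rewrite mulrACA mevalM (eq1 Q hQ) (eq2 Q hQ) -mevalM.
  by rewrite exprD mulrACA.
Qed.

(** Divisors are replaced by their coefficient functions, so that combining equivalences reduces to
    pointwise identities in [int]. *)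
Definition principal (phi : ppoint F -> int) : Prop :=
  exists (d : nat) (G H : {mpoly F[3]}),
    [/\ G \is d.-homog, H \is d.-homog
      & forall P, on_curve a b c P -> exists k l : nat,
          [/\ order d G P k, order d H P l & phi P = k%:Z - l%:Z]].

Lemma linear_equiv0 D : linear_equiv a b c D 0 <-> principal (fun P => coeff P D).
Proof. by rewrite /linear_equiv subr0. Qed.

Lemma eq_principal phi psi : phi =1 psi -> principal phi -> principal psi.
Proof.
move=> e [d [G [H [hG hH h]]]]; exists d, G, H; split=> // P /h [k [l []]].
by rewrite e => ? ? ?; exists k, l.
Qed.

Lemma principalD phi psi :
  principal phi -> principal psi -> principal (fun P => phi P + psi P).
Proof.
move=> [d1 [G1 [H1 [hG1 hH1 h1]]]] [d2 [G2 [H2 [hG2 hH2 h2]]]].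
exists (d1 + d2)%N, (G1 * G2), (H1 * H2); rewrite !dhomogM //; split=> // P hP.
have [k1 [l1 [? ? ->]]] := h1 P hP; have [k2 [l2 [? ? ->]]] := h2 P hP.
exists (k1 + k2)%N, (l1 + l2)%N; split; try exact: vanishing_orderM.
lia.
Qed.

Lemma principalN phi : principal phi -> principal (fun P => - phi P).
Proof.
move=> [d [G [H [hG hH h]]]]; exists d, H, G; split=> // P /h [k [l [? ? ->]]].
by exists l, k; split=> //; rewrite opprB.
Qed.

Lemma principal_sum phi psi : principal phi ->
  principal (fun P => phi P + psi P) <-> principal psi.
Proof.
move=> hphi; split=> h; last exact: principalD.
have := principalD h (principalN hphi); apply: eq_principal => P.
by rewrite addrAC subrr add0r.
Qed.

Lemma principal0 : principal (fun=> 0).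
Proof.
exists 0%N, 1, 1; rewrite !dhomog1; split=> // P _; exists 0%N, 0%N; split=> //;
by apply: vanishing_order0; rewrite ?dhomog1 ?meval1 ?oner_neq0.
Qed.

Lemma principalMn phi n : principal phi -> principal (fun P => phi P * n%:Z).
Proof.
move=> h; elim: n => [|n IH].
  by apply: eq_principal principal0 => P; rewrite mulr0.
apply: eq_principal (principalD IH h) => P; lia.
Qed.

Definition delta (P Q : ppoint F) : int := (P == Q)%:Z.

Lemma coeff_dpoint P Q : coeff Q (dpoint P) = delta P Q.
Proof. by rewrite coeffU mul1r /delta; case: (P == Q). Qed.

Lemma order_Z_at_infinity : order 1 'X_2 None 3.
Proof.
(* Collecting the multiples of Z in the equation of the curve gives Z V = - X^3, where V, the
   quadratic form below, equals 1 at infinity. *)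
exists 0%N, 2%N, (- 1), ('X_1 * 'X_1 - (a + b + c) *: ('X_0 * 'X_0)
  + (a * b + b * c + c * a) *: ('X_0 * 'X_2) - (a * b * c) *: ('X_2 * 'X_2)).
split=> //.
- by rewrite rpredN dhomog1 mevalN meval1 oppr_eq0 oner_neq0.
- split; first by prove_homog.
  rewrite !mevals.
  have -> : 1 * 1 - (a + b + c) * (0 * 0) + (a * b + b * c + c * a) * (0 * 0)
    - a * b * c * (0 * 0) = 1 :> F by ring.
  exact: oner_neq0.
- move=> [[x y]|] hQ; rewrite /local_param !mevals; last by ring.
  move/on_curve_affine: hQ; rewrite /cubic_at => e.
  ring: e.
Qed.
End Curve.

(** * Divisors of vertical and oblique lines *)

Section Lines.
Variables (F : closedFieldType) (a b c : F).
Hypotheses (two_neq0 : 2 != 0 :> F) (ab : a != b) (bc : b != c) (ac : a != c).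
Notation order := (vanishing_order a b c).
Notation principal := (principal a b c).

Lemma order_Z_affine p : order 1 'X_2 (Some p) 0.
Proof.
case: p => x y; apply: vanishing_order0; first exact: homogX.
by rewrite !mevals oner_neq0.
Qed.

Lemma cubic_root e : cubic_at a b c e = 0 ->
  exists g h, [/\ g != h, g != e, h != e
    & forall x, cubic_at a b c x = (e - x) * (g - x) * (h - x)].
Proof.
move/eqP; rewrite /cubic_at !mulf_eq0 !subr_eq0 -orbA.
case/or3P=> /eqP <-; [exists b, c|exists a, c|exists a, b]; split=> //;
  by rewrite 1?eq_sym //= => x; ring.
Qed.

(** At the branch point [(e, 0)] the local parameter is [y]; the relation y^2 = (x - e) h with h
    nonzero there shows that x - e has order two. *)
Lemma cofactor_form e : cubic_at a b c e = 0 ->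
  exists h : {mpoly F[3]},
    [/\ h \is 2.-homog, forall y, h.@[hcoords (Some (e, y))] != 0,
        h.@[hcoords None] = 0
      & forall x y, cubic_at a b c x = (x - e) * h.@[hcoords (Some (x, y))]].
Proof.
move=> /cubic_root [g [h [_ ge he E]]].
exists (- ((g *: 'X_2 - 'X_0) * (h *: 'X_2 - 'X_0))); split.
- by prove_homog.
- by move=> y; rewrite !mevals !mulr1 oppr_eq0 mulf_neq0 ?subr_eq0.
- by rewrite !mevals; ring.
- by move=> x y; rewrite !mevals E; ring.
Qed.

Lemma delta_affine x y u w :
  delta (Some (x, y)) (Some (u, w) : ppoint F) = ((x == u) && (y == w))%:Z.
Proof. by []. Qed.

Lemma principal_conj x y : y ^+ 2 = cubic_at a b c x ->
  principal (fun P => delta (Some (x, y)) P + delta (Some (x, - y)) P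
                      - 2%:Z * delta None P).
Proof.
move=> hxy; exists 1%N, ('X_0 - x *: 'X_2), 'X_2.
split; [by prove_homog|by prove_homog|move=> [[u w]|] hP]; last first.
  exists 1%N, 3%N; split=> //; last exact: order_Z_at_infinity.
  (* With V such that Z V = - X^3, one has (X - x Z) V = X (V + x X^2). The first form is V + x X^2
     and the second is V, so the order at infinity is one. *)
  exists 2%N, 2%N, ('X_1 * 'X_1 - (a + b + c - x) *: ('X_0 * 'X_0)
    + (a * b + b * c + c * a) *: ('X_0 * 'X_2) - (a * b * c) *: ('X_2 * 'X_2)),
   ('X_1 * 'X_1 - (a + b + c) *: ('X_0 * 'X_0)
    + (a * b + b * c + c * a) *: ('X_0 * 'X_2) - (a * b * c) *: ('X_2 * 'X_2)).
  split=> //.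
  - split; first by prove_homog.
    by rewrite !mevals !mulr0 subr0 addr0 subr0 mulr1 oner_neq0.
  - split; first by prove_homog.
    by rewrite !mevals !mulr0 subr0 addr0 subr0 mulr1 oner_neq0.
  - move=> [[v z]|] hQ; rewrite /local_param !mevals; last by ring.
    move/on_curve_affine: hQ; rewrite /cubic_at => e; ring: e.
have hw := (on_curve_affine a b c u w).1 hP.
have dN : delta None (Some (u, w) : ppoint F) = 0 by [].
rewrite dN !delta_affine mulr0 subr0.
have [xu|xu] := eqVneq x u; last first.
  exists 0%N, 0%N; split=> //; last exact: order_Z_affine.
  apply: vanishing_order0; first by prove_homog.
  by rewrite !mevals mulr1 subr_eq0 eq_sym.
have [w0|w0] := eqVneq w 0.
  have y0 : y = 0 by apply/eqP; rewrite -sqrf_eq0 hxy xu -hw w0 expr0n.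
  exists 2%N, 0%N; split; [|exact: order_Z_affine|].
    have [|h [hh h1 h2 h3]] := cofactor_form (e := x).
      by rewrite -hxy y0 expr0n.
    exists 1%N, 2%N, 'X_2, h; split=> //.
    - by split; [prove_homog|rewrite !mevals oner_neq0].
    - by rewrite -xu.
    - move=> [[v z]|] hQ; rewrite /local_param w0 eqxx !mevals ?h2; last by ring.
      have /on_curve_affine := hQ; rewrite !mulr1 (h3 _ z) mulrC => e.
      by rewrite e.
  by rewrite y0 w0 oppr0 eqxx.
exists 1%N, 0%N; split; [|exact: order_Z_affine|].
  exists 0%N, 0%N, 1, 1; rewrite dhomog1 meval1 oner_neq0; split=> //.
  by move=> Q _; rewrite /local_param (negPf w0) xu mulr1 mul1r.
have : y ^+ 2 == w ^+ 2 by rewrite hxy hw xu.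
have wN : (- w == w) = false.
  by rewrite eq_sym -addr_eq0 -mulr2n -mulr_natl mulf_eq0 (negPf two_neq0) (negPf w0).
by rewrite eqf_sqr => /orP[] /eqP ->; rewrite /= ?opprK eqxx wN.
Qed.

(** At a point of the line with [y] nonzero, multiplying the line by y + m x + k gives - (x - x1) (x
    - x2) (x - x3), and this multiplier does not vanish. At a branch point on the line the parameter
    is [y] and the line equals y (1 - m y / h), with [h] from [cofactor_form], so the order is
    one. *)
Lemma principal_line m k x1 x2 x3 :
  (forall x, cubic_at a b c x - (m * x + k) ^+ 2 =
             - ((x - x1) * (x - x2) * (x - x3))) ->
  principal (fun P => delta (Some (x1, m * x1 + k)) P
    + delta (Some (x2, m * x2 + k)) P + delta (Some (x3, m * x3 + k)) P
    - 3%:Z * delta None P).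
Proof.
move=> E; exists 1%N, ('X_1 - m *: 'X_0 - k *: 'X_2), 'X_2.
split; [by prove_homog|by prove_homog|move=> [[u w]|] hP]; last first.
  exists 0%N, 3%N; split=> //; last exact: order_Z_at_infinity.
  apply: vanishing_order0; first by prove_homog.
  by rewrite !mevals !mulr0 !subr0 oner_neq0.
have hw := (on_curve_affine a b c u w).1 hP.
have -> : delta None (Some (u, w) : ppoint F) = 0 by [].
rewrite !delta_affine mulr0 subr0.
have [wE|wE] := eqVneq w (m * u + k); last first.
  exists 0%N, 0%N; split; [|exact: order_Z_affine|].
    apply: vanishing_order0; first by prove_homog.
    by rewrite !mevals mulr1 -addrA -opprD subr_eq0.
  have d0 z : (z == u) && (m * z + k == w) = false.
    by apply/negP => /andP[/eqP -> /eqP e]; rewrite e eqxx in wE.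
  by rewrite !d0.
have d0 z : (z == u) && (m * z + k == w) = (z == u).
  by case: eqVneq => //= ->; rewrite wE eqxx.
rewrite !d0; have [w0|w0] := eqVneq w 0; last first.
  exists ((x1 == u) + (x2 == u) + (x3 == u))%N, 0%N.
  split; [|exact: order_Z_affine|by rewrite subr0 !PoszD].
  have fact z : exists U : {mpoly F[3]}, [/\ U \is (1 - (z == u)).-homog,
      U.@[hcoords (Some (u, w))] != 0 &
      forall Q, ('X_0 - z *: 'X_2).@[hcoords Q] =
        (('X_0 - u *: 'X_2) ^+ (z == u)).@[hcoords Q] * U.@[hcoords Q]].
    case: eqVneq => [->|zu].
      exists 1; rewrite dhomog1 meval1 oner_neq0; split=> // Q.
      by rewrite expr1 meval1 mulr1.
    exists ('X_0 - z *: 'X_2); split=> //; first by prove_homog.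
      by rewrite !mevals mulr1 subr_eq0 eq_sym.
    by move=> Q; rewrite expr0 meval1 mul1r.
  have [[U1 [h1 n1 e1]] [U2 [h2 n2 e2]] [U3 [h3 n3 e3]]] :=
    And3 (fact x1) (fact x2) (fact x3).
  exists (1 - (x1 == u) + (1 - (x2 == u)) + (1 - (x3 == u)))%N, 2%N,
    (- (U1 * U2 * U3)), ('X_2 * ('X_1 + m *: 'X_0 + k *: 'X_2)).
  split.
  - by rewrite rpredN !dhomogM // !mevals oppr_eq0 !mulf_neq0.
  - split; first by prove_homog.
    rewrite !mevals mul1r mulr1 -addrA -wE -mulr2n -mulr_natl.
    by rewrite mulf_neq0.
  - by move: (x1 == u) (x2 == u) (x3 == u) => [] [] [].
  - move=> Q hQ; rewrite /local_param (negPf w0) !exprD mulrN mevalN.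
    transitivity (- (('X_0 - x1 *: 'X_2).@[hcoords Q] *
      ('X_0 - x2 *: 'X_2).@[hcoords Q] * ('X_0 - x3 *: 'X_2).@[hcoords Q])).
      case: Q hQ => [[v z]|] hQ; rewrite !mevals; last by ring.
      have /on_curve_affine e := hQ.
      rewrite !mulr1 -E -e; ring.
    by rewrite e1 e2 e3 !mevalM; ring.
have f0 : cubic_at a b c u = 0 by rewrite -hw w0 expr0n.
have k_def : k = - (m * u).
  by apply/eqP; rewrite -addr_eq0 addrC -wE w0.
exists 1%N, 0%N; split; [|exact: order_Z_affine|].
  have [h [hh h1 h2 h3]] := cofactor_form f0.
  exists 2%N, 2%N, (h - m *: ('X_1 * 'X_2)), h; split=> //.
  - split; first by apply: rpredB => //; prove_homog.
    by rewrite mevalB !mevals w0 mul0r mulr0 subr0.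
  - move=> Q hQ; rewrite /local_param w0 eqxx mevalM mevalM !mevalB.
    case: Q hQ => [[v z]|] hQ; rewrite !mevals ?h2; last by ring.
    have /on_curve_affine := hQ; rewrite (h3 _ z) => e.
    rewrite k_def; ring: e.
have [g [h [gh gu hu fE]]] := cubic_root f0.
(* The order being one, [u] must occur only once among the three abscissas. If it occurred twice,
   evaluation at the other roots [g], [h] of the cubic would give m^2 = g - z3 = h - z3. *)
have simple z1 z2 z3 : z1 = u -> (forall x, cubic_at a b c x - (m * x + k) ^+ 2 =
    - ((x - z1) * (x - z2) * (x - z3))) -> z2 != u.
  move=> -> H; apply/eqP => z2u.
  have m2 z : z != u -> cubic_at a b c z = 0 -> m ^+ 2 = z - z3.
    move=> zu fz; have := H z; rewrite fz k_def z2u => e.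
    have zu2 : (z - u) ^+ 2 != 0 by rewrite expf_neq0 ?subr_eq0.
    apply: (mulfI zu2).
    by transitivity (- (0 - (m * z - m * u) ^+ 2)); [ring|rewrite e; ring].
  have eg := m2 g gu; have eh := m2 h hu.
  rewrite !fE !subrr !mulr0 mul0r in eg eh.
  by move/eqP: gh; apply; apply: (addIr (- z3)); rewrite -eg // eh.
have : (x1 == u) || (x2 == u) || (x3 == u).
  have /eqP := E u; rewrite f0 -wE w0 expr0n subr0 eq_sym oppr_eq0.
  by rewrite !mulf_eq0 !subr_eq0 !(eq_sym u).
have E12 x : cubic_at a b c x - (m * x + k) ^+ 2 = - ((x - x1) * (x - x3) * (x - x2)).
  by rewrite E; ring.
have E21 x : cubic_at a b c x - (m * x + k) ^+ 2 = - ((x - x2) * (x - x1) * (x - x3)).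
  by rewrite E; ring.
have E23 x : cubic_at a b c x - (m * x + k) ^+ 2 = - ((x - x2) * (x - x3) * (x - x1)).
  by rewrite E; ring.
have E31 x : cubic_at a b c x - (m * x + k) ^+ 2 = - ((x - x3) * (x - x1) * (x - x2)).
  by rewrite E; ring.
have E32 x : cubic_at a b c x - (m * x + k) ^+ 2 = - ((x - x3) * (x - x2) * (x - x1)).
  by rewrite E; ring.
case/orP=> [/orP[]|] /eqP xu.
- by rewrite (negPf (simple _ _ _ xu E)) (negPf (simple _ _ _ xu E12)) xu eqxx.
- by rewrite (negPf (simple _ _ _ xu E21)) (negPf (simple _ _ _ xu E23)) xu eqxx.
- by rewrite (negPf (simple _ _ _ xu E31)) (negPf (simple _ _ _ xu E32)) xu eqxx.
Qed.
End Lines.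

(** * Distinct points are not equivalent *)

Lemma poly_eq_horner (F : closedFieldType) (p q : {poly F}) :
  (forall x, p.[x] = q.[x]) -> p = q.
Proof.
move=> pq; apply/eqP; rewrite -subr_eq0; apply/negPn/negP => /closed_nonrootP.
by case=> x; rewrite rootE hornerD hornerN pq subrr eqxx.
Qed.

Lemma exists_sqrt (F : closedFieldType) (z : F) : exists y, y ^+ 2 = z.
Proof.
have /closed_rootP [y] : size ('X^2 - z%:P) != 1%N by rewrite size_XnsubC.
by rewrite rootE !hornerE subr_eq0 => /eqP; exists y.
Qed.

Section Inequivalence.
Variables (F : closedFieldType) (a b c : F).
Notation order := (vanishing_order a b c).
Notation principal := (principal a b c).

(** * Functions A + B y and their norms *)

Definition cubic_poly : {poly F} := (a%:P - 'X) * (b%:P - 'X) * (c%:P - 'X).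

Lemma horner_cubic_poly x : cubic_poly.[x] = cubic_at a b c x.
Proof. by rewrite !hornerE. Qed.

Lemma cubic_polyE : cubic_poly = - (('X - a%:P) * ('X - b%:P) * ('X - c%:P)).
Proof. by rewrite /cubic_poly; ring. Qed.

Lemma size_cubic_poly : size cubic_poly = 4%N.
Proof.
by rewrite cubic_polyE size_polyN !size_mul ?mulf_neq0 ?polyXsubC_eq0 // !size_XsubC.
Qed.

Lemma lead_coef_cubic_poly : lead_coef cubic_poly = -1.
Proof.
by rewrite cubic_polyE lead_coefN !lead_coefM !lead_coefXsubC !mulr1.
Qed.

Lemma cubic_poly_neq0 : cubic_poly != 0.
Proof. by rewrite -size_poly_eq0 size_cubic_poly. Qed.

(** The product of A + B y with its conjugate A - B y; its degree is the pole order of A + B y at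
    infinity. *)
Definition pair_norm (A B : {poly F}) : {poly F} := A ^+ 2 - cubic_poly * B ^+ 2.

Lemma pair_normE A B x y : y ^+ 2 = cubic_at a b c x ->
  (pair_norm A B).[x] = (A.[x] + B.[x] * y) * (A.[x] + B.[x] * - y).
Proof.
move=> e; rewrite /pair_norm !expr2 hornerD hornerN.
by rewrite !(hornerM A, hornerM B, hornerM cubic_poly) horner_cubic_poly -e; ring.
Qed.

Lemma size_sqr (p : {poly F}) : size (p ^+ 2) = (size p + size p).-1.
Proof.
have [->|p0] := eqVneq p 0; first by rewrite expr0n size_poly0.
by rewrite expr2 size_mul.
Qed.

Lemma size_cubicM (p : {poly F}) : p != 0 ->
  size (cubic_poly * p ^+ 2) = (size p + size p + 2)%N.
Proof.
move=> p0; rewrite size_mul ?cubic_poly_neq0 ?expf_neq0 // size_sqr size_cubic_poly.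
by move: p0; rewrite -size_poly_eq0; case: (size p) => // n _; lia.
Qed.

(** A nonzero [A ^+ 2] has even degree and [cubic_poly * B ^+ 2] odd degree, so their leading terms
    cannot cancel. *)
Lemma size_pair_norm A B : B != 0 ->
  size (pair_norm A B) = maxn (size A + size A).-1 (size B + size B + 2).
Proof.
move=> B0; rewrite /pair_norm -size_sqr -size_cubicM // maxnC.
have [lt|gt|e] := ltngtP (size (A ^+ 2)) (size (cubic_poly * B ^+ 2)).
- by rewrite addrC size_polyDl ?size_polyN //; symmetry; apply/maxn_idPl/ltnW.
- by rewrite size_polyDl ?size_polyN //; symmetry; apply/maxn_idPr/ltnW.
- move: e; rewrite size_cubicM // size_sqr => e; exfalso.
  by case: (size A) e => [|s]; move: B0; rewrite -size_poly_eq0; lia.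
Qed.

Lemma pair_norm_eq0 A B : pair_norm A B = 0 -> A = 0 /\ B = 0.
Proof.
have [->|B0] := eqVneq B 0.
  rewrite /pair_norm expr0n mulr0 subr0 => /eqP.
  by rewrite sqrf_eq0 => /eqP.
move=> N0; have := size_pair_norm A B0; rewrite N0 size_poly0.
by have := leq_maxr (size A + size A).-1 (size B + size B + 2); lia.
Qed.

(* x and y have poles of order 2 and 3 at infinity, so a form of degree e that
   does not vanish there has a pole of order exactly 3e. *)
Definition pole_le w (A B : {poly F}) :=
  (size A <= w./2.+1)%N && (size B <= w.-1./2)%N.

(** The coefficient of the only monomial, x^i or x^i y according to the parity of [w], with a pole
    of order exactly [w]. For [w = 1] there is none, and the truncated subtraction selects the
    constant coefficient of [B]. *)
Definition pole_coef w (A B : {poly F}) :=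
  if odd w then B`_((w - 3)./2) else A`_(w./2).

Lemma size_pair_norm_pole w A B : w != 1%N -> pole_le w A B -> pole_coef w A B != 0 ->
  size (pair_norm A B) = w.+1.
Proof.
rewrite /pole_le /pole_coef => w1 /andP[hA hB] top.
have size_le (p : {poly F}) k : p`_k != 0 -> (k < size p)%N.
  by apply: contraR; rewrite -leqNgt => /leq_sizeP ->.
case: ifP top => ow /size_le top.
  have B0 : B != 0 by rewrite -size_poly_eq0; lia.
  by rewrite size_pair_norm //; lia.
have [B0|B0] := eqVneq B 0; last first.
  by rewrite size_pair_norm //; move: B0; rewrite -size_poly_eq0; lia.
by rewrite /pair_norm B0 expr0n mulr0 subr0 size_sqr; lia.
Qed.

Lemma size_cubicX i j :
  size ('X^i * cubic_poly ^+ j) = (i + 3 * j).+1.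
Proof.
rewrite mulrC size_mulXn ?expf_neq0 ?cubic_poly_neq0 // -addnS; congr (_ + _)%N.
elim: j => [|j IH]; first by rewrite expr0 size_poly1.
by rewrite exprS size_mul ?expf_neq0 ?cubic_poly_neq0 // IH size_cubic_poly; lia.
Qed.

Lemma coef_cubicX i j k : (i + 3 * j <= k)%N ->
  ('X^i * cubic_poly ^+ j)`_k = (-1) ^+ j * (k == i + 3 * j)%N%:R.
Proof.
rewrite leq_eqVlt => /orP[/eqP <-|lt].
  rewrite eqxx mulr1 -[X in _`_X]/((i + 3 * j).+1.-1) -size_cubicX -/(lead_coef _).
  by rewrite lead_coefM lead_coefXn mul1r lead_coef_exp lead_coef_cubic_poly.
by rewrite nth_default ?size_cubicX // gtn_eqF // mulr0.
Qed.

(** By linearity a monomial X^i Y^j Z^k suffices, and even powers of y become powers of the cubic.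
    The pole order 2 i + 3 j falls short of 3 e by i + 3 k, so only Y^e reaches it, and Y^e is also
    the only monomial that is nonzero at infinity. The sign comes from the leading coefficient -1 of
    the cubic. *)
Lemma form_pair e (G : {mpoly F[3]}) : G \is e.-homog ->
  exists A B : {poly F},
   [/\ forall x y, y ^+ 2 = cubic_at a b c x ->
         G.@[hcoords (Some (x, y))] = A.[x] + B.[x] * y,
       pole_le (3 * e) A B
     & pole_coef (3 * e) A B = (-1) ^+ e./2 * G.@[hcoords None]].
Proof.
move=> hG; rewrite (mpolyE G).
have coef_lin p0 p1 q0 q1 z : pole_coef (3 * e) (z *: p0 + q0) (z *: p1 + q1) =
    z * pole_coef (3 * e) p0 p1 + pole_coef (3 * e) q0 q1.
  by rewrite /pole_coef; case: ifP => _; rewrite coefD coefZ.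
have le_lin p0 p1 q0 q1 z : pole_le (3 * e) p0 p1 -> pole_le (3 * e) q0 q1 ->
    pole_le (3 * e) (z *: p0 + q0) (z *: p1 + q1).
  move=> /andP[h1 h2] /andP[h3 h4]; apply/andP; split.
    by rewrite (leq_trans (size_polyD _ _)) // geq_max h3 (leq_trans (size_scale_leq _ _)).
  by rewrite (leq_trans (size_polyD _ _)) // geq_max h4 (leq_trans (size_scale_leq _ _)).
rewrite big_seq; elim/big_rec: _ => [|m p mG [A [B [ev le co]]]].
  exists 0, 0; split=> [x y _||].
  - by rewrite meval0 !horner0 mul0r addr0.
  - by rewrite /pole_le size_poly0.
  - by rewrite /pole_coef !coef0 meval0 mulr0 if_same.
have {mG} : mdeg m = e by have /dhomogP h := hG; exact: h.
rewrite mdegE !big_ord_recl big_ord0 addn0.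
have mE v : ('X_[m]).@[v] =
    v 0 ^+ m 0 * (v 1 ^+ m 1 * v 2 ^+ m 2) :> F.
  rewrite mevalX !big_ord_recl big_ord0 mulr1.
  by congr (_ * (_ ^+ _ * _ ^+ _)); congr (_ _); apply/val_inj.
have -> : fintype.lift ord0 (fintype.lift ord0 ord0) = 2 :> 'I_3 by apply/val_inj.
have -> : fintype.lift ord0 ord0 = 1 :> 'I_3 by apply/val_inj.
have -> : (ord0 : 'I_3) = 0%R by apply/val_inj.
set i := m 0; set j := m 1; set k := m 2 => deg.
pose q := 'X^i * cubic_poly ^+ j./2.
suff [A1 [B1 [ev1 le1 co1]]] : exists A B : {poly F},
   [/\ forall x y, y ^+ 2 = cubic_at a b c x ->
         x ^+ i * y ^+ j = A.[x] + B.[x] * y,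
       pole_le (3 * e) A B
     & pole_coef (3 * e) A B = (-1) ^+ e./2 * (0 ^+ i * 0 ^+ k)].
  exists (G@_m *: A1 + A), (G@_m *: B1 + B); split.
  - move=> x y hxy; rewrite mevalD mevalZ ev // mE !hcoords_affine.
    by rewrite expr1n mulr1 ev1 // !hornerE /=; ring.
  - exact: le_lin.
  - rewrite coef_lin co co1 mevalD mevalZ mE !hcoords_infinity.
    by rewrite expr1n mul1r /=; ring.
have jE : j = (odd j + j./2.*2)%N by rewrite odd_double_half.
have qE x y : y ^+ 2 = cubic_at a b c x -> q.[x] = x ^+ i * y ^+ (j./2.*2).
  move=> hxy; rewrite hornerM hornerXn horner_exp.
  by rewrite horner_cubic_poly -hxy -exprM mul2n.
have ik0 : (0 ^+ i * 0 ^+ k : F) = ((i == 0) && (k == 0))%N%:R.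
  by rewrite !expr0n -natrM mulnb.
have sq := size_cubicX i j./2; rewrite -/q in sq.
have cq l : (i + 3 * j./2 <= l)%N ->
    q`_l = (-1) ^+ j./2 * (l == i + 3 * j./2)%N%:R by exact: coef_cubicX.
case: (boolP (odd j)) => oj; rewrite ?oj ?(negPf oj) in jE.
- exists 0, q; split.
  + move=> x y hxy; rewrite horner0 add0r (qE _ y) // {1}jE exprD expr1; ring.
  + by rewrite /pole_le size_poly0 sq /=; lia.
  + rewrite /pole_coef ik0; case: ifP => oe; last first.
      by rewrite coef0 (_ : _ && _ = false) ?mulr0 //; lia.
    rewrite cq; last by lia.
    have -> : ((3 * e - 3)./2 == i + 3 * j./2)%N = (i == 0)%N && (k == 0)%N by lia.
    case: (boolP (_ && _)) => [/andP[/eqP i0 /eqP k0]|_]; last by rewrite !mulr0.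
    by rewrite -deg i0 k0 add0n addn0.
- exists q, 0; split.
  + by move=> x y hxy; rewrite horner0 mul0r addr0 (qE _ y) // {1}jE.
  + by rewrite /pole_le size_poly0 sq /=; lia.
  + rewrite /pole_coef ik0; case: ifP => oe.
      by rewrite coef0 (_ : _ && _ = false) ?mulr0 //; lia.
    rewrite cq; last by lia.
    have -> : ((3 * e)./2 == i + 3 * j./2)%N = (i == 0)%N && (k == 0)%N by lia.
    case: (boolP (_ && _)) => [/andP[/eqP i0 /eqP k0]|_]; last by rewrite !mulr0.
    by rewrite -deg i0 k0 add0n addn0.
Qed.

Hypothesis two_neq0 : 2 != 0 :> F.

(** Evaluation at [y] and [- y] separates the two parts. The values at branch points ignore [B], so
    what vanishes everywhere is first its product with the cubic. *)
Lemma pair_eq0 (A B : {poly F}) :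
  (forall x y, y ^+ 2 = cubic_at a b c x -> A.[x] + B.[x] * y = 0) ->
  A = 0 /\ B = 0.
Proof.
move=> H.
have H2 x : A.[x] = 0 /\ B.[x] * cubic_at a b c x = 0.
  have [y hy] := exists_sqrt (cubic_at a b c x).
  have e1 := H x y hy; have e2 := H x (- y); rewrite sqrrN in e2.
  have {}e2 := e2 hy.
  have A0 : A.[x] = 0.
    apply: (mulfI two_neq0); rewrite mulr0.
    by transitivity ((A.[x] + B.[x] * y) + (A.[x] + B.[x] * - y));
      [ring|rewrite e1 e2 addr0].
  split=> //; rewrite -hy expr2 mulrA; move: e1; rewrite A0 add0r => ->.
  by rewrite mul0r.
split; first by apply: poly_eq_horner => x; rewrite horner0; case: (H2 x).
apply: (mulIf cubic_poly_neq0); apply: poly_eq_horner => x.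
by rewrite hornerM horner_cubic_poly mul0r horner0; case: (H2 x).
Qed.

Lemma pair_eq (A B A' B' : {poly F}) :
  (forall x y, y ^+ 2 = cubic_at a b c x ->
     A.[x] + B.[x] * y = A'.[x] + B'.[x] * y) -> A = A' /\ B = B'.
Proof.
move=> H; have [|e1 e2] := @pair_eq0 (A - A') (B - B').
  move=> x y /H e; rewrite !hornerE -(subrr (A'.[x] + B'.[x] * y)) -{1}e; ring.
by split; apply/eqP; rewrite -subr_eq0 ?e1 ?e2.
Qed.

(* A root of M is a zero of A0 + B0 y, as the multiplier V is nonzero there;
   this removes the roots of M from the denominator one at a time. *)
Lemma regular_pair (M A0 B0 : {poly F}) : M != 0 ->
  (forall x y, y ^+ 2 = cubic_at a b c x ->
     exists V0 V1 W0 W1 : {poly F},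
       [/\ V0.[x] + V1.[x] * y != 0, V0 * A0 + V1 * B0 * cubic_poly = W0 * M
         & V0 * B0 + V1 * A0 = W1 * M]) ->
  exists A B : {poly F}, A0 = A * M /\ B0 = B * M.
Proof.
elim: {M}(size M) {-2}M (erefl (size M)) A0 B0 => [|s IH] M sM A0 B0 M0 H.
  by move/eqP: sM; rewrite size_poly_eq0 (negPf M0).
have [/eqP/size_poly1P [u u0 ->]|] := eqVneq (size M) 1%N.
  exists (u^-1 *: A0), (u^-1 *: B0).
  by rewrite -!(mulrC u%:P) !mul_polyC !scalerA divff // !scale1r.
move/closed_rootP => [x Mx]; have /factor_theorem [M' ME] := Mx.
have {}Mx : M.[x] = 0 by apply/eqP.
have [y hy] := exists_sqrt (cubic_at a b c x).
have g0 z : z ^+ 2 = cubic_at a b c x -> A0.[x] + B0.[x] * z = 0.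
  move=> hz; have [V0 [V1 [W0 [W1 [nV e1 e2]]]]] := H x z hz.
  have := congr1 (horner^~ x) e1; have := congr1 (horner^~ x) e2.
  rewrite !(hornerD, hornerM V0, hornerM V1, hornerM W0, hornerM W1,
    hornerM (_ * _) cubic_poly) horner_cubic_poly Mx !mulr0 => h1 h2.
  apply: (mulfI nV); rewrite mulr0.
  transitivity ((V0.[x] * A0.[x] + V1.[x] * B0.[x] * cubic_at a b c x)
     + (V0.[x] * B0.[x] + V1.[x] * A0.[x]) * z); last by rewrite h1 h2; ring.
  by rewrite -hz; ring.
have A0x : A0.[x] = 0.
  apply: (mulfI two_neq0); rewrite mulr0.
  have := g0 (- y); rewrite sqrrN => /(_ hy) e2; have e1 := g0 y hy.
  by transitivity ((A0.[x] + B0.[x] * y) + (A0.[x] + B0.[x] * - y));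
    [ring|rewrite e1 e2 addr0].
have B0x : B0.[x] = 0.
  (* Away from branch points [B0] vanishes because [A0] does. At a branch point the second equation,
     evaluated at [x], reads V0 B0 = 0, and [V0.[x]] is the nonzero value of the multiplier since
     [y = 0]. *)
  have [y0|y0] := eqVneq y 0; last first.
    by apply: (mulIf y0); rewrite mul0r -[LHS]add0r -{1}A0x g0.
  have [V0 [V1 [W0 [W1 [nV e1 e2]]]]] := H x y hy.
  have := congr1 (horner^~ x) e2.
  rewrite !(hornerD, hornerM) A0x Mx !mulr0 addr0 => /eqP.
  rewrite mulf_eq0 => /orP[] /eqP // V0x.
  by rewrite V0x y0 mulr0 addr0 eqxx in nV.
have /factor_theorem [A1 A1E] : root A0 x by apply/eqP.
have /factor_theorem [B1 B1E] : root B0 x by apply/eqP.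
have X0 : 'X - x%:P != 0 by rewrite polyXsubC_eq0.
have M'0 : M' != 0 by apply: contraNneq M0 => M'0; rewrite ME M'0 mul0r.
have [||A [B [e1 e2]]] := IH M' _ A1 B1 M'0.
- by move: sM; rewrite ME size_mul // size_XsubC addn2 /= => -[].
- move=> z w hw; have [V0 [V1 [W0 [W1 [nV e1 e2]]]]] := H z w hw.
  exists V0, V1, W0, W1; split=> //; apply: (mulIf X0).
    by move: e1; rewrite A1E B1E ME => e; rewrite -[RHS]mulrA -e; ring.
  by move: e2; rewrite A1E B1E ME => e; rewrite -[RHS]mulrA -e; ring.
by exists A, B; rewrite A1E B1E ME e1 e2 !mulrA.
Qed.

Lemma local_param_eq0 P : (local_param P).@[hcoords P] = 0 :> F.
Proof.
case: P => [[x y]|]; rewrite /local_param; last by rewrite mevalXU.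
by have [->|_] := eqVneq y 0; rewrite !mevals ?mulr1 ?subrr.
Qed.

Lemma homog_local_param P : (local_param P : {mpoly F[3]}) \is 1.-homog.
Proof.
by case: P => [[x y]|]; rewrite /local_param ?homogX //; case: ifP => _; prove_homog.
Qed.

Lemma quotient_order d (G H : {mpoly F[3]}) P k l :
  order d G P k -> order d H P l -> (l <= k)%N ->
  exists (e f : nat) (V W : {mpoly F[3]}),
    [/\ V \is e.-homog, W \is f.-homog, V.@[hcoords P] != 0
      & forall Q, on_curve a b c Q ->
        (V * G).@[hcoords Q] = (local_param P ^+ (k - l) * W * H).@[hcoords Q]].
Proof.
move=> [e1 [f1 [U1 [V1 [[hU1 nU1] [hV1 nV1] deg1 eq1]]]]].
move=> [e2 [f2 [U2 [V2 [[hU2 nU2] [hV2 nV2] deg2 eq2]]]]] lk.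
exists (f1 + e2)%N, (e1 + f2)%N, (V1 * U2), (U1 * V2).
rewrite !dhomogM // mevalM mulf_neq0 //; split=> // Q hQ.
have tk : (local_param P : {mpoly F[3]}) ^+ k
  = local_param P ^+ (k - l) * local_param P ^+ l by rewrite -exprD subnK.
have := eq1 Q hQ; have := eq2 Q hQ; rewrite tk !mevalM => h2 h1.
transitivity (V1.@[hcoords Q] * G.@[hcoords Q] * U2.@[hcoords Q]); first by ring.
rewrite h1; transitivity ((local_param P ^+ (k - l)).@[hcoords Q] * U1.@[hcoords Q]
  * (V2.@[hcoords Q] * H.@[hcoords Q])); last by ring.
by rewrite h2; ring.
Qed.

(** The degree 3 e is the intersection number of a curve of degree [e] with the cubic; the norm sees
    all of it once no intersection lies at infinity. *)
Lemma form_norm e (V : {mpoly F[3]}) : V \is e.-homog -> V.@[hcoords None] != 0 ->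
  exists A B : {poly F},
    (forall x y, y ^+ 2 = cubic_at a b c x ->
      V.@[hcoords (Some (x, y))] = A.[x] + B.[x] * y)
    /\ size (pair_norm A B) = (3 * e).+1.
Proof.
move=> hV nV; have [A [B [ev le co]]] := form_pair hV.
exists A, B; split=> //; apply: size_pair_norm_pole => //; first by lia.
by rewrite co mulf_neq0 // expf_neq0 // oppr_eq0 oner_neq0.
Qed.

Lemma principal_two_poles x1 y1 x2 y2 :
  y1 ^+ 2 = cubic_at a b c x1 -> y2 ^+ 2 = cubic_at a b c x2 ->
  principal (fun P => delta (Some (x1, y1)) P + delta (Some (x2, y2)) P
                      - 2%:Z * delta None P) ->
  x1 = x2 /\ y2 = - y1.
Proof.
move=> hP1 hP2 [d [G [H [hG hH div]]]].
have [G0 [G1 [evG _ _]]] := form_pair hG.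
have [H0 [H1 [evH _ _]]] := form_pair hH.
have [k [l [ordG ordH]]] := div None (on_curve_infinity a b c).
have -> : delta (Some (x1, y1)) None + delta (Some (x2, y2)) None
  - 2%:Z * delta (None : ppoint F) None = - 2%:Z by [].
move=> kl; have {kl} lk : l = k.+2 by lia.
(* If [H] vanished on the affine curve, its local equation at infinity would make ['X_0 ^+ l * U]
   vanish there too, although [U], nonzero at infinity, has a nonzero norm. *)
have NH0 : pair_norm H0 H1 != 0.
  apply/eqP => /pair_norm_eq0 [H0E H1E].
  have [e [f [U [V [[hU nU] _ _ eqH]]]]] := ordH.
  have [U0 [U1 [evU sizeU]]] := form_norm hU nU.
  have [] := @pair_eq0 ('X^l * U0) ('X^l * U1).
    move=> x y hxy.
    have := eqH (Some (x, y)) ((on_curve_affine a b c x y).2 hxy).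
    rewrite !mevalM evH // H0E H1E !horner0 mul0r addr0 mulr0 /local_param.
    by rewrite !mevals evU // !hornerM hornerXn => ->; ring.
  move=> /eqP; rewrite mulf_eq0 expf_eq0 polyX_eq0 andbF => /eqP U0E.
  move=> /eqP; rewrite mulf_eq0 expf_eq0 polyX_eq0 andbF => /eqP U1E.
  by move: sizeU; rewrite U0E U1E /pair_norm !expr0n mulr0 subr0 size_poly0.
(* Multiplying by the conjugate of [H] turns G / H into (A0 + B0 y) / [pair_norm H0 H1], whose
   denominator involves x alone. *)
have [A0 A0E] : exists A0, A0 = G0 * H0 - G1 * H1 * cubic_poly by eexists.
have [B0 B0E] : exists B0, B0 = G1 * H0 - G0 * H1 by eexists.
have ev0 x y : y ^+ 2 = cubic_at a b c x -> A0.[x] + B0.[x] * y =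
    (G0.[x] + G1.[x] * y) * (H0.[x] + H1.[x] * - y).
  move=> hxy; rewrite A0E B0E !(hornerD, hornerN, hornerM G0, hornerM G1,
    hornerM (_ * _) cubic_poly) horner_cubic_poly -hxy; ring.
have quot x y : y ^+ 2 = cubic_at a b c x ->
  exists (m : nat) (V0 V1 W0 W1 w0 w1 : {poly F}),
    [/\ delta (Some (x1, y1)) (Some (x, y)) + delta (Some (x2, y2)) (Some (x, y))
         = m%:Z,
      V0.[x] + V1.[x] * y != 0,
      forall u w, w ^+ 2 = cubic_at a b c u -> W0.[u] + W1.[u] * w =
        (local_param (Some (x, y))).@[hcoords (Some (u, w))] ^+ m
        * (w0.[u] + w1.[u] * w),
      V0 * A0 + V1 * B0 * cubic_poly = W0 * pair_norm H0 H1
    & V0 * B0 + V1 * A0 = W1 * pair_norm H0 H1].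
  move=> hxy; have hon := (on_curve_affine a b c x y).2 hxy.
  have [k' [l' [oG oH]]] := div _ hon.
  have -> : delta (None : ppoint F) (Some (x, y)) = 0 by [].
  rewrite mulr0 subr0 => kl'.
  have lk' : (l' <= k')%N.
    have : (0 <= k'%:Z - l'%:Z) by rewrite -kl'; apply: addr_ge0.
    by rewrite subr_ge0.
  have [e [f [V [W [hV hW nV eqVW]]]]] := quotient_order oG oH lk'.
  have [V0 [V1 [evV _ _]]] := form_pair hV.
  have hW' : (local_param (Some (x, y)) ^+ (k' - l') * W) \is (1 * (k' - l') + f).-homog.
    by apply: dhomogM => //; apply/dhomogMn/homog_local_param.
  have [W0 [W1 [evW _ _]]] := form_pair hW'.
  have [w0 [w1 [evw _ _]]] := form_pair hW.
  have [] := @pair_eq (V0 * A0 + V1 * B0 * cubic_poly) (V0 * B0 + V1 * A0)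
     (W0 * pair_norm H0 H1) (W1 * pair_norm H0 H1).
    move=> u w huw; have := eqVW (Some (u, w)) ((on_curve_affine a b c u w).2 huw).
    rewrite mevalM [RHS]mevalM evV // evG // evH // evW // => E.
    rewrite (hornerM W0) (hornerM W1) !(pair_normE _ _ huw) !(hornerD,
      hornerM V0, hornerM V1, hornerM (_ * _) cubic_poly) horner_cubic_poly.
    transitivity ((V0.[u] + V1.[u] * w) * (A0.[u] + B0.[u] * w)).
      by rewrite -huw; ring.
    rewrite ev0 // mulrA E; ring.
  move=> e1 e2; exists (k' - l')%N, V0, V1, W0, W1, w0, w1; split=> //.
  - by rewrite kl' subzn.
  - by rewrite -evV.
  - by move=> u w huw; rewrite -evW // -evw // mevalM mevalXn.
have [A [B [AE BE]]] : exists A B : {poly F},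
    A0 = A * pair_norm H0 H1 /\ B0 = B * pair_norm H0 H1.
  apply: (regular_pair NH0) => x y hxy.
  have [m [V0 [V1 [W0 [W1 [w0 [w1 [_ n _ e1 e2]]]]]]]] := quot x y hxy.
  by exists V0, V1, W0, W1.
have normE : pair_norm A B * pair_norm H0 H1 = pair_norm G0 G1.
  apply: (mulIf NH0); transitivity (pair_norm A0 B0).
    by rewrite AE BE /pair_norm; ring.
  by rewrite A0E B0E /pair_norm; ring.
(* Norms of the local equations at infinity give x^4 N(V1 U2) N(A + B y) = N(U1 V2), where 4 = 2 (l
   - k). The forms [V1 * U2] and [U1 * V2] differ in degree by l - k = 2, their norms by 6, and 6 -
   4 = 2. *)
have size_AB : size (pair_norm A B) = 3%N.
  have [e1 [f1 [U1 [V1 [[hU1 nU1] [hV1 nV1] deg1 eq1]]]]] := ordG.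
  have [e2 [f2 [U2 [V2 [[hU2 nU2] [hV2 nV2] deg2 eq2]]]]] := ordH.
  have [|V0 [V' [evV sV]]] := form_norm (dhomogM hV1 hU2).
    by rewrite mevalM mulf_neq0.
  have [|W0 [W' [evW sW]]] := form_norm (dhomogM hU1 hV2).
    by rewrite mevalM mulf_neq0.
  have E : pair_norm V0 V' * ('X^4 * pair_norm A B) = pair_norm W0 W'.
    have Xk0 : ('X^(2 * k) : {poly F}) != 0 by rewrite expf_neq0 ?polyX_eq0.
    apply: (mulfI Xk0); apply: (mulIf NH0).
    transitivity ('X^(2 * l) * pair_norm V0 V' * pair_norm G0 G1).
      by rewrite lk -normE (_ : (2 * k.+2 = 2 * k + 4)%N) ?exprD; [ring|clear; lia].
    apply: poly_eq_horner => x; have [y hxy] := exists_sqrt (cubic_at a b c x).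
    have ptw w : w ^+ 2 = cubic_at a b c x ->
      x ^+ l * (V0.[x] + V'.[x] * w) * (G0.[x] + G1.[x] * w) =
      x ^+ k * (W0.[x] + W'.[x] * w) * (H0.[x] + H1.[x] * w).
      move=> hw; have hon := (on_curve_affine a b c x w).2 hw.
      have := eq1 _ hon; have := eq2 _ hon.
      rewrite /local_param !mevals -evV // -evW // -evG // -evH // !mevalM => h2 h1.
      transitivity (V1.@[hcoords (Some (x, w))] * G.@[hcoords (Some (x, w))]
        * (x ^+ l * U2.@[hcoords (Some (x, w))])); first by ring.
      by rewrite h1 -h2; ring.
    rewrite !(hornerM _ (pair_norm _ _), hornerM 'X^_) !hornerXn.
    rewrite !(pair_normE _ _ hxy) !(mulnC 2) !exprM.
    have := ptw (- y); rewrite sqrrN => /(_ hxy) p2; have p1 := ptw y hxy.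
    transitivity ((x ^+ l * (V0.[x] + V'.[x] * y) * (G0.[x] + G1.[x] * y)) *
      (x ^+ l * (V0.[x] + V'.[x] * - y) * (G0.[x] + G1.[x] * - y))); first by ring.
    by rewrite p1 p2; ring.
  have N0 : pair_norm A B != 0.
    apply: contra_eq_neq sW => N0; by rewrite -E N0 !mulr0 size_poly0.
  move: sW; rewrite -E size_mul ?mulf_neq0 ?expf_neq0 ?polyX_eq0 //; last first.
    by rewrite -size_poly_eq0 sV.
  rewrite (mulrC 'X^4) size_mulXn // sV; clear -deg1 deg2 lk.
  by move: (size _) => s; lia.
(* A nonzero term in y would have a pole of order at least three. *)
have B_0 : B = 0.
  apply/eqP; apply: contra_eqT size_AB => nB; rewrite size_pair_norm //.
  by move: nB; rewrite -size_poly_eq0; move: (size A) (size B); clear; lia.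
move: size_AB; rewrite /pair_norm B_0 expr0n mulr0 subr0 size_sqr => sA2.
have sA : size A = 2%N by move: (size A) sA2; clear; lia.
have B0_0 : B0 = 0 by rewrite BE B_0 mul0r.
have rootA x y : y ^+ 2 = cubic_at a b c x ->
    delta (Some (x1, y1)) (Some (x, y)) + delta (Some (x2, y2)) (Some (x, y)) != 0 ->
    A.[x] = 0.
  move=> hxy; have [m [V0 [V1 [W0 [W1 [w0 [w1 [-> nV evW e1 e2]]]]]]]] := quot x y hxy.
  move=> m0; have {e1} e1 : V0 * A = W0.
    by apply: (mulIf NH0); rewrite -e1 AE B0_0; ring.
  have {e2} e2 : V1 * A = W1.
    by apply: (mulIf NH0); rewrite -e2 AE B0_0; ring.
  have := evW x y hxy; rewrite local_param_eq0 expr0n.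
  have -> : (m == 0)%N = false by case: m m0 {evW}.
  rewrite mul0r -e1 -e2 !hornerM => z; apply: (mulfI nV); rewrite mulr0 -z; ring.
have A1 : A.[x1] = 0.
  by apply: (rootA _ y1) => //; rewrite /delta eqxx; case: (Some (x2, y2) == _).
have A2 : A.[x2] = 0.
  by apply: (rootA _ y2) => //; rewrite /delta eqxx; case: (Some (x1, y1) == _).
have [u AF] : exists u, A = u *: ('X - x1%:P).
  have /factor_theorem [q qE] : root A x1 by apply/eqP.
  have : size q = 1%N.
    have q0 : q != 0 by apply: contraTneq isT => q0; move: sA; rewrite qE q0 mul0r size_poly0.
    by move: sA; rewrite qE size_mul ?polyXsubC_eq0 // size_XsubC addn2 /= => -[].
  by move=> /eqP/size_poly1P [u _ qu]; exists u; rewrite qE qu mul_polyC.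
have u0 : u != 0 by apply: contraTneq isT => u0; move: sA; rewrite AF u0 scale0r size_poly0.
have x12 : x2 = x1.
  move: A2; rewrite AF hornerZ hornerXsubC => /eqP.
  by rewrite mulf_eq0 (negPf u0) subr_eq0 => /eqP.
split=> //; have : y2 ^+ 2 == y1 ^+ 2 by rewrite hP1 hP2 x12.
rewrite eqf_sqr => /orP[/eqP y12|/eqP //].
have [y10|y10] := eqVneq y1 0; first by rewrite y12 y10 oppr0.
(* It remains to exclude [y2 = y1] with [y1] nonzero. The function would have a double zero where x
   - x1 is a local parameter, which forces the multiplier V0 + V1 y to vanish there. *)
have [m [V0 [V1 [W0 [W1 [w0 [w1 [mE nV evW e1 e2]]]]]]]] := quot x1 y1 hP1.
have {mE} m2 : m = 2%N.
  by move: mE; rewrite x12 y12 /delta eqxx; clear; lia.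
exfalso.
have {e1} e1 : V0 * A = W0 by apply: (mulIf NH0); rewrite -e1 AE B0_0; ring.
have {e2} e2 : V1 * A = W1 by apply: (mulIf NH0); rewrite -e2 AE B0_0; ring.
have [] := @pair_eq (V0 * A) (V1 * A)
    (('X - x1%:P) ^+ 2 * w0) (('X - x1%:P) ^+ 2 * w1).
  move=> u1 w hw; rewrite e1 e2 evW // m2 /local_param (negPf y10) !mevals mulr1.
  by rewrite !(hornerM _ w0, hornerM _ w1) !horner_exp !hornerXsubC; ring.
rewrite AF => {}e1 {}e2; have X0 : 'X - x1%:P != 0 by rewrite polyXsubC_eq0.
have V0x : V0.[x1] = 0.
  apply: (mulfI u0); rewrite mulr0.
  have -> : u * V0.[x1] = (u *: V0).[x1] by rewrite hornerZ.
  have -> : u *: V0 = ('X - x1%:P) * w0.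
    by apply: (mulIf X0); rewrite -scalerAl scalerAr e1; ring.
  by rewrite hornerM hornerXsubC subrr mul0r.
have V1x : V1.[x1] = 0.
  apply: (mulfI u0); rewrite mulr0.
  have -> : u * V1.[x1] = (u *: V1).[x1] by rewrite hornerZ.
  have -> : u *: V1 = ('X - x1%:P) * w1.
    by apply: (mulIf X0); rewrite -scalerAl scalerAr e2; ring.
  by rewrite hornerM hornerXsubC subrr mul0r.
by rewrite V0x V1x mul0r addr0 eqxx in nV.
Qed.

Hypotheses (ab : a != b) (bc : b != c) (ac : a != c).

Lemma principal_inj x1 y1 x2 y2 :
  y1 ^+ 2 = cubic_at a b c x1 -> y2 ^+ 2 = cubic_at a b c x2 ->
  principal (fun P => delta (Some (x1, y1)) P - delta (Some (x2, y2)) P) ->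
  x1 = x2 /\ y1 = y2.
Proof.
move=> h1 h2 h; have h2' : (- y2) ^+ 2 = cubic_at a b c x2 by rewrite sqrrN.
have [|-> e] := principal_two_poles h1 h2'.
  apply: eq_principal (principalD h (principal_conj two_neq0 ab bc ac h2)) => P; ring.
by split=> //; rewrite -[y2]opprK e opprK.
Qed.
End Inequivalence.

(** * Translations of half-points *)

Section HalfPoints.
Variables (F : closedFieldType) (a b c : F).
Hypotheses (two_neq0 : 2 != 0 :> F) (ab : a != b) (bc : b != c) (ac : a != c).
Notation principal := (principal a b c).

(* Twice this point has abscissa l, where r, s, t are square roots of a - l,
   b - l, c - l; two sign changes translate it by a point of order two. *)
Definition half_point (r s t : F) : F * F :=
  (a - r ^+ 2 - (r * s + s * t + t * r), (r + s) * (s + t) * (t + r)).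

Definition roots_at (r s t : F) : Prop :=
  s ^+ 2 = b - a + r ^+ 2 /\ t ^+ 2 = c - a + r ^+ 2.

Lemma half_point_on_curve r s t : roots_at r s t ->
  (half_point r s t).2 ^+ 2 = cubic_at a b c (half_point r s t).1.
Proof.
case=> hs ht; rewrite /half_point /cubic_at /=.
have -> : b = a + s ^+ 2 - r ^+ 2 by rewrite hs; ring.
have -> : c = a + t ^+ 2 - r ^+ 2 by rewrite ht; ring.
ring.
Qed.

(** For the half-point (x, y) one has a - x = (r + s) (t + r) and two analogues, so each sum of two
    roots is y divided by one of these differences, and the sums determine the roots. No sum
    vanishes because the squares of the roots are distinct. *)
Lemma half_point_inj r s t r' s' t' :
  roots_at r s t -> roots_at r' s' t' ->
  half_point r s t = half_point r' s' t' -> [/\ r = r', s = s' & t = t'].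
Proof.
move=> h h' [eX eY].
have aux u v w : roots_at u v w -> [/\ u + v != 0, v + w != 0 & w + u != 0] /\
    [/\ a - (half_point u v w).1 = (u + v) * (w + u),
    b - (half_point u v w).1 = (u + v) * (v + w)
   & c - (half_point u v w).1 = (v + w) * (w + u)].
  case=> hv hw; rewrite /half_point /=; split; split.
  - apply: contraNneq ab => e; rewrite -subr_eq0 -oppr_eq0.
    have -> : - (a - b) = (u + v) * (v - u) by transitivity (v ^+ 2 - u ^+ 2); [rewrite hv|]; ring.
    by rewrite e mul0r.
  - apply: contraNneq bc => e; rewrite -subr_eq0.
    have -> : b - c = (v + w) * (v - w) by transitivity (v ^+ 2 - w ^+ 2); [rewrite hv hw|]; ring.
    by rewrite e mul0r.
  - apply: contraNneq ac => e; rewrite -subr_eq0 -oppr_eq0.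
    have -> : - (a - c) = (w + u) * (w - u) by transitivity (w ^+ 2 - u ^+ 2); [rewrite hw|]; ring.
    by rewrite e mul0r.
  - ring.
  - by transitivity (v ^+ 2 + (u * v + v * w + w * u)); [rewrite hv|]; ring.
  - by transitivity (w ^+ 2 + (u * v + v * w + w * u)); [rewrite hw|]; ring.
have [[n1 n2 n3] [e1 e2 e3]] := aux _ _ _ h; have [_ [f1 f2 f3]] := aux _ _ _ h'.
rewrite /= eX in e1 e2 e3; rewrite /= in f1 f2 f3.
have E1 : r + s = r' + s'.
  apply: (mulIf (mulf_neq0 n2 n3)); rewrite -{2}e3 f3.
  by rewrite mulrA eY mulrA.
have E2 : s + t = s' + t'.
  apply: (mulIf (mulf_neq0 n1 n3)); rewrite -{2}e1 f1.
  by rewrite mulrCA mulrA eY; ring.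
have E3 : t + r = t' + r'.
  apply: (mulIf (mulf_neq0 n1 n2)); rewrite -{2}e2 f2.
  by rewrite mulrC eY; ring.
have fin (u v : F) : 2 * u = 2 * v -> u = v by exact: (mulfI two_neq0).
split; apply: fin.
- transitivity ((r + s) + (t + r) - (s + t)); first by ring.
  by rewrite E1 E2 E3; ring.
- transitivity ((r + s) + (s + t) - (t + r)); first by ring.
  by rewrite E1 E2 E3; ring.
- transitivity ((s + t) + (t + r) - (r + s)); first by ring.
  by rewrite E1 E2 E3; ring.
Qed.

Lemma roots_at_opp r s t r' s' t' : roots_at r s t ->
  r' ^+ 2 = r ^+ 2 -> s' ^+ 2 = s ^+ 2 -> t' ^+ 2 = t ^+ 2 -> roots_at r' s' t'.
Proof. by case=> hs ht hr' hs' ht'; split; rewrite ?hs' ?ht' hr'. Qed.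

(** Addition on the cubic: the line through the two summands meets it again in the conjugate of [P],
    and subtracting the divisor of the vertical line through [P] leaves [P] and the point at
    infinity. *)
Lemma principal_chord m k x1 x2 (P : F * F) :
  P.2 ^+ 2 = cubic_at a b c P.1 ->
  (forall x, cubic_at a b c x - (m * x + k) ^+ 2 =
             - ((x - x1) * (x - x2) * (x - P.1))) ->
  m * P.1 + k = - P.2 ->
  principal (fun Q => delta (Some (x1, m * x1 + k)) Q
    + delta (Some (x2, m * x2 + k)) Q - delta (Some P) Q - delta None Q).
Proof.
case: P => x y /= hP E e.
have := principalD (principal_line two_neq0 ab bc ac E)
  (principalN (principal_conj two_neq0 ab bc ac hP)).
by rewrite e; apply: eq_principal => Q; ring.
Qed.

(** The line of slope - (r + s) through (c, 0) contains the half-point because c - x = (s + t) (t +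
    r). The same identity with [r], [s] negated shows that it contains the conjugate of the other
    half-point. *)
Lemma principal_add_c r s t : roots_at r s t ->
  principal (fun Q => delta (Some (c, 0)) Q + delta (Some (half_point r s t)) Q
    - delta (Some (half_point (- r) (- s) t)) Q - delta None Q).
Proof.
move=> h; have [hs ht] := h.
have h' : roots_at (- r) (- s) t by apply: roots_at_opp h _ _ _; rewrite ?sqrrN.
have bE : b = a + s ^+ 2 - r ^+ 2 by rewrite hs; ring.
have cE : c = a + t ^+ 2 - r ^+ 2 by rewrite ht; ring.
apply: (@eq_principal _ _ _ _ _ _ _ (principal_chord (m := - (r + s))
  (k := (r + s) * c) (x1 := c) (x2 := (half_point r s t).1)
  (half_point_on_curve h') _ _)).
- move=> Q; have -> : - (r + s) * c + (r + s) * c = 0 by ring.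
  congr (_ + delta (Some _) Q - _ - _).
  by rewrite /half_point /= cE; congr (_, _); ring.
- by move=> x; rewrite /cubic_at /half_point /= bE cE; ring.
- by rewrite /half_point /= cE; ring.
Qed.

Lemma principal_add_b r s t : roots_at r s t ->
  principal (fun Q => delta (Some (b, 0)) Q + delta (Some (half_point r s t)) Q
    - delta (Some (half_point (- r) s (- t))) Q - delta None Q).
Proof.
move=> h; have [hs ht] := h.
have h' : roots_at (- r) s (- t) by apply: roots_at_opp h _ _ _; rewrite ?sqrrN.
have bE : b = a + s ^+ 2 - r ^+ 2 by rewrite hs; ring.
have cE : c = a + t ^+ 2 - r ^+ 2 by rewrite ht; ring.
apply: (@eq_principal _ _ _ _ _ _ _ (principal_chord (m := - (r + t))
  (k := (r + t) * b) (x1 := b) (x2 := (half_point r s t).1)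
  (half_point_on_curve h') _ _)).
- move=> Q; have -> : - (r + t) * b + (r + t) * b = 0 by ring.
  congr (_ + delta (Some _) Q - _ - _).
  by rewrite /half_point /= bE; congr (_, _); ring.
- by move=> x; rewrite /cubic_at /half_point /= bE cE; ring.
- by rewrite /half_point /= bE; ring.
Qed.

Lemma principal_torsion :
  [/\ principal (fun Q => delta (Some (a, 0)) Q + delta (Some (b, 0)) Q
        + delta (Some (c, 0)) Q - 3%:Z * delta None Q),
      principal (fun Q => 2%:Z * delta (Some (a, 0)) Q - 2%:Z * delta None Q),
      principal (fun Q => 2%:Z * delta (Some (b, 0)) Q - 2%:Z * delta None Q)
    & principal (fun Q => 2%:Z * delta (Some (c, 0)) Q - 2%:Z * delta None Q)].
Proof.
have two x : cubic_at a b c x = 0 ->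
    principal (fun Q => 2%:Z * delta (Some (x, 0)) Q - 2%:Z * delta None Q).
  move=> h; have h0 : 0 ^+ 2 = cubic_at a b c x by rewrite h expr0n.
  have := principal_conj two_neq0 ab bc ac h0; rewrite oppr0.
  by apply: eq_principal => Q; ring.
split; try by apply: two; rewrite /cubic_at !(subrr, mul0r, mulr0).
have := @principal_line F a b c two_neq0 ab bc ac 0 0 a b c.
rewrite !mul0r !addr0; apply => x.
by rewrite /cubic_at; ring.
Qed.

(* In the application k^2 = a - b, I^2 = -1, and the endpoints of a chord of the
   ellipse have eccentric angles m - h and m + h, where C = cos m, S = sin m,
   p = cos h, q = sin h. *)
Lemma principal_chord_step (I k mu C S p q y0 r s t r' s' t' : F) :
  I ^+ 2 = -1 -> C ^+ 2 + S ^+ 2 = 1 -> p ^+ 2 + q ^+ 2 = 1 -> mu != 0 ->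
  a = mu ^+ 2 + k ^+ 2 * C ^+ 2 -> b = mu ^+ 2 - k ^+ 2 * S ^+ 2 ->
  c * mu ^+ 2 = a * b * q ^+ 2 -> y0 * mu = - (a * b * q) ->
  r = k * (C * p + S * q) -> s = I * (k * (S * p - C * q)) ->
  t = - I * (mu * p - k ^+ 2 * S * C * q / mu) ->
  r' = - k * (C * p - S * q) -> s' = - I * (k * (S * p + C * q)) ->
  t' = - I * (mu * p + k ^+ 2 * S * C * q / mu) ->
  roots_at r s t /\
  principal (fun Q => delta (Some (0, y0)) Q + delta (Some (half_point r s t)) Q
    - delta (Some (half_point r' s' t')) Q - delta None Q).
Proof.
move=> hI hC hp mu0 aE bE cE yE rE sE tE rE' sE' tE'.
have {}hC : C ^+ 2 = 1 - S ^+ 2 by rewrite -hC addrK.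
have {}hp : p ^+ 2 = 1 - q ^+ 2 by rewrite -hp addrK.
have mu20 : mu ^+ 2 != 0 by rewrite expf_neq0.
have {}cE : c = a * b * q ^+ 2 / mu ^+ 2 by rewrite -cE mulfK.
have {}yE : y0 = - (a * b * q) / mu by rewrite -yE mulfK.
have h : roots_at r s t.
  split.
    by rewrite aE bE rE sE; ring: hI hC hp.
  by rewrite cE bE aE rE tE; field: hI hC hp.
have h' : roots_at r' s' t'.
  split.
    by rewrite aE bE rE' sE'; ring: hI hC hp.
  by rewrite cE bE aE rE' tE'; field: hI hC hp.
split=> //.
(* The slope of the line through (0, y0) and the first half-point, written without dividing by the
   abscissa of that point. *)
pose m := - k * (C + I * S) * p + mu * q - k ^+ 2 * C * (I * S) * q / mu.
apply: (@eq_principal _ _ _ _ _ _ _ (principal_chord (m := m)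
  (k := y0) (x1 := 0) (x2 := (half_point r s t).1)
  (half_point_on_curve h') _ _)).
- move=> Q; rewrite mulr0 add0r.
  congr (_ + delta (Some _) Q - _ - _).
  rewrite /half_point /= /m yE rE sE tE bE aE; congr (_, _).
  by field: hI hC hp.
- move=> x; rewrite /cubic_at /half_point /= /m cE yE rE sE tE rE' sE' tE' bE aE.
  by field: hI hC hp.
- rewrite /half_point /= /m yE rE' sE' tE' bE aE.
  by field: hI hC hp.
Qed.
End HalfPoints.

(** * Chords tangent to the caustic *)

Section Billiard.
Variables (R : realType) (a b c : R).
Hypotheses (b_gt0 : 0 < b) (ab : b < a) (c_gt0 : 0 < c) (cb : c != b) (ca : c != a).
Implicit Types p q r u v w : R * R.

Let a_gt0 : 0 < a. Proof. exact: lt_trans ab. Qed.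
Let a0 : a != 0. Proof. exact: lt0r_neq0. Qed.
Let b0 : b != 0. Proof. exact: lt0r_neq0. Qed.

Lemma on_boundary p : on_conic a b 0 p <-> p.1 ^+ 2 / a + p.2 ^+ 2 / b = 1.
Proof. by rewrite /on_conic !(eq_sym 0) (negPf b0) (negPf a0) !subr0. Qed.

(* Tangent of the angle from the outer normal at q to the line q r. *)
Definition slope q r : R :=
  (q.1 / a * (r.2 - q.2) - q.2 / b * (r.1 - q.1)) /
  (q.1 / a * (r.1 - q.1) + q.2 / b * (r.2 - q.2)).

Lemma normal_chord q r : on_conic a b 0 q -> on_conic a b 0 r ->
  q.1 / a * (r.1 - q.1) + q.2 / b * (r.2 - q.2) =
  - ((r.1 - q.1) ^+ 2 / a + (r.2 - q.2) ^+ 2 / b) / 2.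
Proof.
move=> /on_boundary hq /on_boundary hr; apply/eqP; rewrite -subr_eq0; apply/eqP.
transitivity (((r.1 ^+ 2 / a + r.2 ^+ 2 / b) - (q.1 ^+ 2 / a + q.2 ^+ 2 / b)) / 2).
  by field; rewrite a0 b0.
by rewrite hq hr subrr mul0r.
Qed.

Lemma quad_gt0 x y : (x, y) != (0, 0) :> R * R -> 0 < x ^+ 2 / a + y ^+ 2 / b.
Proof.
have h (z e : R) : 0 < e -> 0 <= z ^+ 2 / e by move=> e0; rewrite divr_ge0 ?sqr_ge0 // ltW.
rewrite xpair_eqE negb_and => /orP[] z0.
  by rewrite ltr_wpDr ?h // divr_gt0 // exprn_even_gt0.
by rewrite ltr_wpDl ?h // divr_gt0 // exprn_even_gt0.
Qed.

Lemma chord_neq0 q r : q != r -> (r.1 - q.1, r.2 - q.2) != (0, 0).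
Proof.
apply: contraNneq => -[/eqP + /eqP]; rewrite !subr_eq0 => /eqP e1 /eqP e2.
by case: q r e1 e2 => [? ?] [? ?] /= -> ->.
Qed.

Lemma normal_chord_lt0 q r : on_conic a b 0 q -> on_conic a b 0 r -> q != r ->
  q.1 / a * (r.1 - q.1) + q.2 / b * (r.2 - q.2) < 0.
Proof.
move=> hq hr qr; rewrite normal_chord // mulNr oppr_lt0 divr_gt0 //.
exact/quad_gt0/chord_neq0.
Qed.

Lemma normal_neq0 q : on_conic a b 0 q -> (q.1 / a) ^+ 2 + (q.2 / b) ^+ 2 != 0.
Proof.
move=> /on_boundary hq; apply: contra_eq_neq hq => e.
have /andP[/eqP e1 /eqP e2] : (q.1 / a == 0) && (q.2 / b == 0).
  by rewrite -!(sqrf_eq0 (_ / _)) -paddr_eq0 ?sqr_ge0 // e.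
rewrite !expr2 -!mulrA e1 e2 !mulr0 addr0 eq_sym; exact: oner_neq0.
Qed.

(** Equal slopes make the two chords proportional. By [normal_chord] the normal component, linear in
    the chord, is also minus half a positive quadratic form of it, which fixes the factor. *)
Lemma slope_inj q r r' : on_conic a b 0 q -> on_conic a b 0 r ->
  on_conic a b 0 r' -> q != r -> q != r' -> slope q r = slope q r' -> r = r'.
Proof.
move=> hq hr hr' qr qr'; rewrite /slope.
have := normal_chord_lt0 hq hr qr; have := normal_chord_lt0 hq hr' qr'.
have := normal_chord hq hr; have := normal_chord hq hr'.
have := quad_gt0 (chord_neq0 qr); have := quad_gt0 (chord_neq0 qr').
have qn := normal_neq0 hq.
set d1 := r.1 - q.1; set d2 := r.2 - q.2; set e1 := r'.1 - q.1; set e2 := r'.2 - q.2.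
set A := q.1 / a; set B := q.2 / b => Qe Qd hNe hNd Ne Nd.
set N := A * d1 + B * d2 in hNd Nd *; set N' := A * e1 + B * e2 in hNe Ne *.
have N0 : N != 0 by rewrite lt_eqF.
have N0' : N' != 0 by rewrite lt_eqF.
move=> /eqP; rewrite eqr_div // => /eqP E.
have x1 : N' * d1 = N * e1.
  apply: (mulfI qn); rewrite -/A -/B.
  transitivity (A * N * N' - B * ((A * d2 - B * d1) * N')); first by rewrite /N; ring.
  by rewrite E /N'; ring.
have x2 : N' * d2 = N * e2.
  apply: (mulfI qn); rewrite -/A -/B.
  transitivity (B * N * N' + A * ((A * d2 - B * d1) * N')); first by rewrite /N; ring.
  by rewrite E /N'; ring.
have QQ : N' ^+ 2 * (d1 ^+ 2 / a + d2 ^+ 2 / b) = N ^+ 2 * (e1 ^+ 2 / a + e2 ^+ 2 / b).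
  transitivity ((N' * d1) ^+ 2 / a + (N' * d2) ^+ 2 / b); first by ring.
  by rewrite x1 x2; ring.
have NN : N' = N.
  apply: (mulfI (mulf_neq0 N0 N0')).
  transitivity (N' ^+ 2 * N); first by ring.
  rewrite hNd; transitivity (- (N' ^+ 2 * (d1 ^+ 2 / a + d2 ^+ 2 / b)) / 2); first by ring.
  rewrite QQ; transitivity (N ^+ 2 * N'); last by rewrite -hNd; ring.
  by rewrite hNe; ring.
rewrite NN in x1 x2; have := mulfI N0 x1; have := mulfI N0 x2.
rewrite /d1 /d2 /e1 /e2 => /addIr h2 /addIr h1.
by case: r r' h1 h2 {hr hr' qr qr' d1 d2 e1 e2 Qe Qd hNe hNd Ne Nd N N' N0 N0' E x1 x2 QQ NN}
  => [? ?] [? ?] /= -> ->.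
Qed.

(** Reflection keeps the tangential component and reverses the normal one. Reading the incoming side
    from [q] towards [p] changes both signs, so in the end only the tangential one differs. *)
Lemma slope_reflection p q r : on_conic a b 0 p -> on_conic a b 0 q ->
  on_conic a b 0 r -> p != q -> q != r -> reflection_law a b p q r ->
  slope q r = - slope q p.
Proof.
move=> hp hq hr pq qr; rewrite /reflection_law /unit_dir /mirror /dot /=.
have pos (x y : R) : (x, y) != (0, 0) -> 0 < Num.sqrt (x * x + y * y).
  rewrite xpair_eqE negb_and sqrtr_gt0 -!expr2 => /orP[] z0.
    by rewrite ltr_wpDr ?sqr_ge0 // exprn_even_gt0.
  by rewrite ltr_wpDl ?sqr_ge0 // exprn_even_gt0.
have n1 := lt0r_neq0 (pos _ _ (chord_neq0 qr)).
have n2 := lt0r_neq0 (pos _ _ (chord_neq0 pq)).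
move: n1 n2; set s1 := Num.sqrt _; set s2 := Num.sqrt _ => n1 n2.
have qp : q != p by rewrite eq_sym.
have := normal_chord_lt0 hq hr qr; have := normal_chord_lt0 hq hp qp.
have qn := normal_neq0 hq.
rewrite /slope; move: qn; set A := q.1 / a; set B := q.2 / b => qn.
set N := A * (p.1 - q.1) + _; set N' := A * (r.1 - q.1) + _ => N_lt N'_lt.
have N0 : N != 0 by rewrite lt_eqF.
have N0' : N' != 0 by rewrite lt_eqF.
rewrite -!expr2; set k := 2 * _ / _ => -[e1 e2].
have eN : N' / s1 = N / s2.
  transitivity (A * ((r.1 - q.1) / s1) + B * ((r.2 - q.2) / s1)); first by rewrite /N'; ring.
  by rewrite e1 e2 /k /N; field; rewrite n2 qn.
have eT : (A * (r.2 - q.2) - B * (r.1 - q.1)) / s1 =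
    - ((A * (p.2 - q.2) - B * (p.1 - q.1)) / s2).
  transitivity (A * ((r.2 - q.2) / s1) - B * ((r.1 - q.1) / s1)); first by ring.
  by rewrite e1 e2; ring.
rewrite -[RHS]mulNr; apply/eqP; rewrite eqr_div //; apply/eqP.
apply: (mulIf (mulf_neq0 (invr_neq0 n1) (invr_neq0 n2))).
transitivity ((A * (r.2 - q.2) - B * (r.1 - q.1)) / s1 * (N / s2)); first by ring.
by rewrite eT -eN; ring.
Qed.

Definition flip (e1 e2 : R) p : R * R := (e1 * p.1, e2 * p.2).

Lemma slope_flip e1 e2 q r : e1 ^+ 2 = 1 -> e2 ^+ 2 = 1 ->
  slope (flip e1 e2 q) (flip e1 e2 r) = e1 * e2 * slope q r.
Proof.
move=> h1 h2; rewrite /slope /flip /= mulrA; congr (_ / _); first by ring.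
transitivity (e1 ^+ 2 * (q.1 / a * (r.1 - q.1)) + e2 ^+ 2 * (q.2 / b * (r.2 - q.2))).
  by ring.
by rewrite h1 h2 !mul1r.
Qed.

Lemma on_conic_flip e1 e2 p : e1 ^+ 2 = 1 -> e2 ^+ 2 = 1 ->
  on_conic a b 0 p -> on_conic a b 0 (flip e1 e2 p).
Proof. by move=> h1 h2 /on_boundary h; apply/on_boundary; rewrite /= !exprMn h1 h2 !mul1r. Qed.

Lemma flip_inj e1 e2 : e1 ^+ 2 = 1 -> e2 ^+ 2 = 1 -> injective (flip e1 e2).
Proof.
move=> h1 h2; apply: (can_inj (g := flip e1 e2)) => -[x y].
by rewrite /flip /= !mulrA -!expr2 h1 h2 !mul1r.
Qed.

(** * Trajectories determined by a vertex and a slope *)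

Section Trajectory.
Variable v : int -> R * R.
Hypothesis hv : billiard_trajectory a b v.

Let on_v i : on_conic a b 0 (v i). Proof. by case: (hv i). Qed.
Let v_neq i : v i != v (i + 1). Proof. by case: (hv i). Qed.

Lemma slope_next i : slope (v (i + 1)) (v (i + 1 + 1)) = - slope (v (i + 1)) (v i).
Proof.
apply: slope_reflection => //.
by have [_ _] := hv (i + 1); rewrite addrK.
Qed.

(** A vertex and the slope of its side fix the other end by [slope_inj], and [slope_next] passes the
    slope on; agreement at 0 and 1 thus spreads in both directions. *)
Lemma trajectory_flip (e1 e2 : R) (n : nat) : e1 ^+ 2 = 1 -> e2 ^+ 2 = 1 ->
  v n = flip e1 e2 (v 0) ->
  slope (v n) (v (n%:Z + 1)) = e1 * e2 * slope (v 0) (v 1) ->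
  forall i, v (i + n%:Z) = flip e1 e2 (v i).
Proof.
move=> h1 h2 e0 es.
have on_flip i : on_conic a b 0 (flip e1 e2 (v i)) by apply: on_conic_flip.
have flip_neq i : flip e1 e2 (v i) != flip e1 e2 (v (i + 1)).
  by rewrite (inj_eq (flip_inj h1 h2)).
pose agree i := v (i + n%:Z) = flip e1 e2 (v i).
have fwd i : agree i -> agree (i + 1) -> agree (i + 1 + 1).
  rewrite /agree => ei ei1.
  apply: (@slope_inj (v (i + 1 + n%:Z))) => //; rewrite ?ei1 //.
    by rewrite (addrAC (i + 1)) -ei1.
  rewrite (addrAC (i + 1)) -ei1 (addrAC i) slope_next -(addrAC i) ei1 ei.
  by rewrite !slope_flip // slope_next mulrN.
have bwd i : agree (i + 1) -> agree (i + 1 + 1) -> agree i.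
  rewrite /agree => ei1 ei2; apply: (@slope_inj (v (i + 1 + n%:Z))) => //.
  - by rewrite (addrAC i) eq_sym.
  - by rewrite ei1 eq_sym.
  apply: oppr_inj; rewrite {1 2}(addrAC i) -slope_next -(addrAC i) -(addrAC (i + 1)).
  by rewrite ei1 ei2 !slope_flip // slope_next mulrN.
have agree0 : agree 0 by rewrite /agree add0r.
have agree1 : agree 1.
  rewrite /agree addrC; apply: (@slope_inj (v n)) => //.
    by rewrite e0; have := flip_neq 0; rewrite add0r.
  by rewrite es e0 slope_flip.
suff H i : agree i /\ agree (i + 1) by move=> i; case: (H i).
elim/int_rect: i => [|i [h3 h4]|i [h3 h4]]; first by rewrite add0r.
  by rewrite -addn1 PoszD; split=> //; apply: fwd.
have -> : - i.+1%:Z + 1 = - i%:Z by rewrite -addn1 PoszD opprD addrNK.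
have E : - i.+1%:Z + 1 = - i%:Z by rewrite -addn1 PoszD opprD addrNK.
by split=> //; apply: bwd; rewrite E.
Qed.
End Trajectory.

(** * Tangency and slopes in terms of eccentric angles *)

Variables al be ga kap : R.
Hypotheses (al_gt0 : 0 < al) (be_gt0 : 0 < be) (ga0 : ga != 0).
Hypotheses (al2 : al ^+ 2 = a) (be2 : be ^+ 2 = b) (ga2 : ga ^+ 2 = c).
Hypothesis kap2 : kap ^+ 2 = a - b.

Let al0 : al != 0. Proof. exact: lt0r_neq0. Qed.
Let be0 : be != 0. Proof. exact: lt0r_neq0. Qed.

(** The tangents u x + w y = Z of the caustic form the dual conic (a - c) u^2 + (b - c) w^2 = Z^2.
    As (u, w) is orthogonal to the chord, it may be replaced by (d2, - d1); the factor u^2 + w^2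
    avoids divisions. *)
Lemma tangent_polar q r : q != r -> tangent_to_conic a b c q r ->
  (a - c) * (r.2 - q.2) ^+ 2 + (b - c) * (r.1 - q.1) ^+ 2 =
  (q.1 * (r.2 - q.2) - q.2 * (r.1 - q.1)) ^+ 2.
Proof.
move=> qr [X [Y [Z [XYZ on hq hr]]]].
have ac0 : a - c != 0 by rewrite subr_eq0 eq_sym.
have bc0 : b - c != 0 by rewrite subr_eq0 eq_sym.
set d1 := r.1 - q.1; set d2 := r.2 - q.2.
pose u := X / (a - c); pose w := Y / (b - c).
have E : u * d1 + w * d2 = 0.
  have : (X * r.1 / (a - c) + Y * r.2 / (b - c)) -
    (X * q.1 / (a - c) + Y * q.2 / (b - c)) = 0 by rewrite hq hr subrr.
  by rewrite /u /w /d1 /d2 => <-; ring.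
have hZ : u * q.1 + w * q.2 = Z by rewrite -hq /u /w; ring.
have hon : (a - c) * u ^+ 2 + (b - c) * w ^+ 2 = Z ^+ 2.
  by rewrite -on /u /w; field; rewrite ac0 bc0.
have uw : (u, w) != (0, 0).
  apply: contraNneq XYZ => -[u0 w0]; move: hZ; rewrite u0 w0 !mul0r addr0 => <-.
  have -> : X = u * (a - c) by rewrite /u divfK.
  have -> : Y = w * (b - c) by rewrite /w divfK.
  by rewrite u0 w0 !mul0r eqxx.
have nz : u ^+ 2 + w ^+ 2 != 0.
  apply: contraNneq uw => e; rewrite xpair_eqE -(sqrf_eq0 u) -(sqrf_eq0 w).
  by rewrite -paddr_eq0 ?sqr_ge0 // e.
apply: (mulIf nz).
have e1 : (u ^+ 2 + w ^+ 2) * d2 ^+ 2 = u ^+ 2 * (d1 ^+ 2 + d2 ^+ 2).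
  transitivity (u ^+ 2 * d2 ^+ 2 + (w * d2) ^+ 2); first by ring.
  by rewrite (_ : w * d2 = - (u * d1)); [ring|apply/eqP; rewrite -addr_eq0 addrC E].
have e2 : (u ^+ 2 + w ^+ 2) * d1 ^+ 2 = w ^+ 2 * (d1 ^+ 2 + d2 ^+ 2).
  transitivity ((u * d1) ^+ 2 + w ^+ 2 * d1 ^+ 2); first by ring.
  by rewrite (_ : u * d1 = - (w * d2)); [ring|apply/eqP; rewrite -addr_eq0 E].
have e3 : (u ^+ 2 + w ^+ 2) * (q.1 * d2 - q.2 * d1) ^+ 2 =
    (u * q.1 + w * q.2) ^+ 2 * (d1 ^+ 2 + d2 ^+ 2).
  apply/eqP; rewrite -subr_eq0; apply/eqP.
  transitivity ((u * d1 + w * d2) * ((u * d1 - w * d2) * (q.2 ^+ 2 - q.1 ^+ 2)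
     - 2 * q.1 * q.2 * (u * d2 + w * d1))).
  ring.
  by rewrite E mul0r.
transitivity ((a - c) * ((u ^+ 2 + w ^+ 2) * d2 ^+ 2)
  + (b - c) * ((u ^+ 2 + w ^+ 2) * d1 ^+ 2)); first by ring.
rewrite e1 e2 [RHS]mulrC e3 hZ -hon; ring.
Qed.

Lemma circle_chord (x y x' y' : R) : x ^+ 2 + y ^+ 2 = 1 -> x' ^+ 2 + y' ^+ 2 = 1 ->
  (x, y) != (x', y') ->
  exists C S p q : R, [/\ C ^+ 2 + S ^+ 2 = 1, p ^+ 2 + q ^+ 2 = 1, 0 < q
    & [/\ x = C * p + S * q, y = S * p - C * q, x' = C * p - S * q
        & y' = S * p + C * q]].
Proof.
move=> h h' ne.
have d_gt0 : 0 < (x' - x) ^+ 2 + (y' - y) ^+ 2.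
  rewrite lt_def addr_ge0 ?sqr_ge0 // andbT; apply: contraNneq ne => /eqP.
  by rewrite paddr_eq0 ?sqr_ge0 // !sqrf_eq0 !subr_eq0 => /andP[/eqP -> /eqP ->].
pose q := Num.sqrt ((x' - x) ^+ 2 + (y' - y) ^+ 2) / 2.
have q_gt0 : 0 < q by rewrite divr_gt0 ?sqrtr_gt0.
have q0 : q != 0 by rewrite gt_eqF.
have q2 : 4 * q ^+ 2 = (x' - x) ^+ 2 + (y' - y) ^+ 2.
  by rewrite /q expr_div_n sqr_sqrtr ?ltW //; field.
(* [(C, S)] is a unit normal of the chord rather than the direction of its midpoint, which is the
   origin for a diameter. *)
pose S := (x - x') / (2 * q); pose C := (y' - y) / (2 * q).
have hS : S ^+ 2 + C ^+ 2 = 1.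
  apply: (mulfI (_ : 4 * q ^+ 2 != 0)); first by rewrite q2 gt_eqF.
  by rewrite mulr1 {2}q2 /S /C; field.
have hC : C ^+ 2 + S ^+ 2 = 1 by rewrite addrC.
have hq : C * y - S * x = - q.
  apply: (mulfI (_ : 4 * q != 0)); first by rewrite mulf_neq0 ?pnatr_eq0.
  transitivity (- (4 * q ^+ 2)); last by ring.
  rewrite q2 /S /C; transitivity (2 * ((y' - y) * y - (x - x') * x)); first by field.
  have -> : (x' - x) ^+ 2 + (y' - y) ^+ 2 =
    (x' ^+ 2 + y' ^+ 2) + (x ^+ 2 + y ^+ 2) - 2 * (x * x' + y * y') by ring.
  rewrite h h'; transitivity (2 * (y * y' + x * x') - 2 * (x ^+ 2 + y ^+ 2)); first by ring.
  by rewrite h; ring.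
pose p := C * x + S * y.
have xE : x = C * p + S * q.
  rewrite -[q]opprK -hq /p; transitivity ((C ^+ 2 + S ^+ 2) * x); [by rewrite hC mul1r|ring].
have yE : y = S * p - C * q.
  rewrite -[q]opprK -hq /p; transitivity ((C ^+ 2 + S ^+ 2) * y); [by rewrite hC mul1r|ring].
exists C, S, p, q; split=> //.
  rewrite -[q]opprK -hq sqrrN -[RHS]mulr1 -{1}hC -h /p; ring.
split=> //.
- have -> : x' = x - 2 * q * S by rewrite /S; field.
  rewrite {1}xE; ring.
- have -> : y' = y + 2 * q * C by rewrite /C; field.
  rewrite {1}yE; ring.
Qed.

(** The quantity mu^2 = a S^2 + b C^2 is the squared semi-diameter parallel to the chord, and
    tangency makes c times it equal to a b q^2. So [mu] is defined from [q] and [ga], whose sign it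
    inherits. *)
Lemma chord_param v w : on_conic a b 0 v -> on_conic a b 0 w -> v != w ->
  tangent_to_conic a b c v w ->
  exists C S p q mu : R,
    [/\ [/\ C ^+ 2 + S ^+ 2 = 1, p ^+ 2 + q ^+ 2 = 1, 0 < q & mu * ga = al * be * q],
        [/\ a = mu ^+ 2 + kap ^+ 2 * C ^+ 2, b = mu ^+ 2 - kap ^+ 2 * S ^+ 2
          & c * mu ^+ 2 = a * b * q ^+ 2],
        [/\ v.1 = al * (C * p + S * q) & v.2 = be * (S * p - C * q)],
        [/\ w.1 = al * (C * p - S * q) & w.2 = be * (S * p + C * q)]
      & [/\ ga * slope v w = - (mu * p) + kap ^+ 2 * S * C * q / mu
          & ga * slope w v = mu * p + kap ^+ 2 * S * C * q / mu]].
Proof.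
move=> hv hw vw tan.
have unit (u : R * R) : on_conic a b 0 u -> (u.1 / al) ^+ 2 + (u.2 / be) ^+ 2 = 1.
  by move=> /on_boundary <-; rewrite !expr_div_n al2 be2.
have [|C [S [p [q [hC hp q_gt0 [v1 v2 w1 w2]]]]]] := circle_chord (unit v hv) (unit w hw).
  apply: contraNneq vw => -[/(mulIf (invr_neq0 al0)) e1 /(mulIf (invr_neq0 be0)) e2].
  by case: v w e1 e2 {hv hw tan} => [? ?] [? ?] /= -> ->.
have {}v1 : v.1 = al * (C * p + S * q) by rewrite -v1 mulrC divfK.
have {}v2 : v.2 = be * (S * p - C * q) by rewrite -v2 mulrC divfK.
have {}w1 : w.1 = al * (C * p - S * q) by rewrite -w1 mulrC divfK.
have {}w2 : w.2 = be * (S * p + C * q) by rewrite -w2 mulrC divfK.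
have q0 : q != 0 by rewrite gt_eqF.
pose mu := al * be * q / ga.
have mu0 : mu != 0 by rewrite !mulf_neq0 ?invr_neq0.
have mu_ga : mu * ga = al * be * q by rewrite /mu divfK.
have hmu : c * mu ^+ 2 = a * b * q ^+ 2.
  by rewrite -ga2 -al2 -be2 /mu; field.
have M : mu ^+ 2 = a * S ^+ 2 + b * C ^+ 2.
  have := tangent_polar vw tan; rewrite v1 v2 w1 w2 => E.
  have {}E : a * b * p ^+ 2 = (a - c) * b * C ^+ 2 + (b - c) * a * S ^+ 2.
    apply: (mulfI (_ : 4 * q ^+ 2 != 0)); first by rewrite mulf_neq0 ?expf_neq0 ?pnatr_eq0.
    transitivity ((al * be * (2 * q) * p * (C ^+ 2 + S ^+ 2)) ^+ 2).
      by rewrite hC -al2 -be2; ring.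
    transitivity ((al * (C * p + S * q) * (be * (S * p + C * q) - be * (S * p - C * q)) -
      be * (S * p - C * q) * (al * (C * p - S * q) - al * (C * p + S * q))) ^+ 2).
      by ring.
    by rewrite -E -al2 -be2; ring.
  apply: (mulfI (lt0r_neq0 c_gt0)); rewrite hmu.
  have -> : q ^+ 2 = 1 - p ^+ 2 by rewrite -hp addrAC subrr add0r.
  by rewrite mulrBr E mulr1 -[a * b]mulr1 -hC; ring.
have aE : a = mu ^+ 2 + kap ^+ 2 * C ^+ 2.
  by rewrite M kap2 -[LHS]mulr1 -hC; ring.
have bE : b = mu ^+ 2 - kap ^+ 2 * S ^+ 2.
  by rewrite M kap2 -[LHS]mulr1 -hC; ring.
exists C, S, p, q, mu; split=> //; split.
- have Q : v.1 / a * (w.1 - v.1) + v.2 / b * (w.2 - v.2) = - (2 * q ^+ 2).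
    rewrite v1 v2 w1 w2 -al2 -be2.
    transitivity (- (2 * q ^+ 2 * (C ^+ 2 + S ^+ 2))); last by rewrite hC mulr1.
    by field; rewrite al0 be0.
  have T : al * be * (v.1 / a * (w.2 - v.2) - v.2 / b * (w.1 - v.1)) =
      2 * q * (mu ^+ 2 * p - kap ^+ 2 * S * C * q).
    rewrite v1 v2 w1 w2 M kap2.
    transitivity (2 * q * (be ^+ 2 * (C * p + S * q) * C + al ^+ 2 * (S * p - C * q) * S)).
      by rewrite -al2 -be2; field; rewrite al0 be0.
    by rewrite al2 be2; ring.
  rewrite /slope Q; apply: (mulfI (mulf_neq0 al0 be0)).
  transitivity (ga * (al * be * (v.1 / a * (w.2 - v.2) - v.2 / b * (w.1 - v.1))) / - (2 * q ^+ 2)).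
    by ring.
  rewrite T; have -> : ga = al * be * q / mu by rewrite -mu_ga mulrC mulKf.
  by field; rewrite mu0 q0.
- have Q : w.1 / a * (v.1 - w.1) + w.2 / b * (v.2 - w.2) = - (2 * q ^+ 2).
    rewrite v1 v2 w1 w2 -al2 -be2.
    transitivity (- (2 * q ^+ 2 * (C ^+ 2 + S ^+ 2))); last by rewrite hC mulr1.
    by field; rewrite al0 be0.
  have T : al * be * (w.1 / a * (v.2 - w.2) - w.2 / b * (v.1 - w.1)) =
      - (2 * q * (mu ^+ 2 * p + kap ^+ 2 * S * C * q)).
    rewrite v1 v2 w1 w2 M kap2.
    transitivity (- (2 * q * (be ^+ 2 * (C * p - S * q) * C + al ^+ 2 * (S * p + C * q) * S))).
      by rewrite -al2 -be2; field; rewrite al0 be0.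
    by rewrite al2 be2; ring.
  rewrite /slope Q; apply: (mulfI (mulf_neq0 al0 be0)).
  transitivity (ga * (al * be * (w.1 / a * (v.2 - w.2) - w.2 / b * (v.1 - w.1))) / - (2 * q ^+ 2)).
    by ring.
  rewrite T; have -> : ga = al * be * q / mu by rewrite -mu_ga mulrC mulKf.
  by field; rewrite mu0 q0.
Qed.

(** By reflection the next side has the opposite of the slope at [w] towards [v], so this positivity
    carries the sign of the slope from side to side. It reduces to that of mu^2 a (b - c) + b c
    kap^2 C^2. *)
Lemma slope_same_side v w : c < b -> on_conic a b 0 v -> on_conic a b 0 w ->
  v != w -> tangent_to_conic a b c v w -> 0 < slope v w * - slope w v.
Proof.
move=> cltb hv hw vw tan.
have [C [S [p [q [mu [[hC hp q_gt0 hmu] [aE bE cE] _ _ [s1 s2]]]]]]] :=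
  chord_param hv hw vw tan.
have mu0 : mu != 0.
  apply: contraTneq q_gt0 => mu0; move/eqP: hmu; rewrite mu0 mul0r eq_sym.
  by rewrite !mulf_eq0 (negPf al0) (negPf be0) /= => /eqP ->; rewrite ltxx.
have mu2 : 0 < mu ^+ 2 by rewrite exprn_even_gt0.
have q2 : 0 < q ^+ 2 by rewrite exprn_gt0.
rewrite -(pmulr_rgt0 _ mu2) -(pmulr_rgt0 _ c_gt0) -(pmulr_rgt0 _ c_gt0).
have -> : c * (c * (mu ^+ 2 * (slope v w * - slope w v))) =
    c * ((mu ^+ 2) ^+ 2 * p ^+ 2 - (kap ^+ 2 * S * C * q) ^+ 2).
  rewrite -{2}ga2; transitivity (c * (mu ^+ 2 * ((ga * slope v w) * - (ga * slope w v)))).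
    by ring.
  by rewrite s1 s2; field.
have -> : p ^+ 2 = 1 - q ^+ 2 by rewrite -hp addrK.
have -> : c * ((mu ^+ 2) ^+ 2 * (1 - q ^+ 2) - (kap ^+ 2 * S * C * q) ^+ 2) =
   q ^+ 2 * (mu ^+ 2 * a * (b - c) + b * c * (kap ^+ 2 * C ^+ 2)).
  transitivity (mu ^+ 2 * (c * mu ^+ 2) - q ^+ 2 * (c * ((mu ^+ 2) ^+ 2 +
    (kap ^+ 2 * S ^+ 2) * (kap ^+ 2 * C ^+ 2)))); first by ring.
  have -> : kap ^+ 2 * S ^+ 2 = mu ^+ 2 - b by rewrite bE; ring.
  have -> : kap ^+ 2 * C ^+ 2 = a - mu ^+ 2 by rewrite aE; ring.
  by rewrite cE; ring.
have bc_ge0 : 0 <= b * c by apply: mulr_ge0; apply: ltW.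
rewrite pmulr_rgt0 //; apply: ltr_wpDr.
  by rewrite mulr_ge0 // mulr_ge0 ?sqr_ge0.
by rewrite mulr_gt0 ?subr_gt0 // mulr_gt0.
Qed.

Lemma opposite_sides v w : b < c -> on_conic a b 0 v -> on_conic a b 0 w ->
  v != w -> tangent_to_conic a b c v w -> v.2 * w.2 < 0.
Proof.
move=> bltc hv hw vw tan.
have [C [S [p [q [mu [[hC hp q_gt0 hmu] [aE bE cE] [_ ->] [_ ->] _]]]]]] :=
  chord_param hv hw vw tan.
have -> : be * (S * p - C * q) * (be * (S * p + C * q)) = b * (S ^+ 2 - q ^+ 2).
  rewrite -be2; transitivity (be ^+ 2 * (S ^+ 2 * p ^+ 2 - C ^+ 2 * q ^+ 2)); first by ring.
  have -> : p ^+ 2 = 1 - q ^+ 2 by rewrite -hp addrK.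
  have -> : C ^+ 2 = 1 - S ^+ 2 by rewrite -hC addrK.
  by ring.
rewrite pmulr_rlt0 // -(pmulr_rlt0 _ b_gt0) -(pmulr_rlt0 _ a_gt0).
have -> : a * (b * (S ^+ 2 - q ^+ 2)) = - (a * S ^+ 2 * (c - b) + b * c * C ^+ 2).
  have M : mu ^+ 2 = a * S ^+ 2 + b * C ^+ 2.
    rewrite aE bE; transitivity (mu ^+ 2 * (C ^+ 2 + S ^+ 2)); last by ring.
    by rewrite hC mulr1.
  transitivity (a * b * S ^+ 2 - a * b * q ^+ 2); first by ring.
  by rewrite -cE M; ring.
rewrite oppr_lt0; have [S0|S0] := eqVneq S 0.
  by rewrite S0 expr0n mulr0 mul0r add0r; move: hC; rewrite S0 expr0n addr0 => ->;
    rewrite mulr1 mulr_gt0.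
have bc_ge0 : 0 <= b * c by apply: mulr_ge0; apply: ltW.
apply: ltr_wpDr; first by rewrite mulr_ge0 ?sqr_ge0.
by rewrite mulr_gt0 ?subr_gt0 // mulr_gt0 // exprn_even_gt0.
Qed.

(** A side on the y-axis would have S = p = 0, so q^2 = 1 and mu^2 = b, and tangency would force c =
    a. *)
Lemma not_vertical v w : on_conic a b 0 v -> on_conic a b 0 w ->
  v != w -> tangent_to_conic a b c v w -> v.1 = 0 -> w.1 = 0 -> False.
Proof.
move=> hv hw vw tan.
have [C [S [p [q [mu [[hC hp q_gt0 hmu] [aE bE cE] [-> _] [-> _] _]]]]]] :=
  chord_param hv hw vw tan.
move=> /eqP; rewrite mulf_eq0 (negPf al0) /= => /eqP e1.
move=> /eqP; rewrite mulf_eq0 (negPf al0) /= => /eqP e2.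
have q0 : q != 0 by rewrite gt_eqF.
have S0 : S = 0.
  apply: (mulIf q0); apply: (mulfI (_ : 2 != 0)); first by rewrite pnatr_eq0.
  transitivity ((C * p + S * q) - (C * p - S * q)); first by ring.
  by rewrite e1 e2 mul0r mulr0 subrr.
have p0 : p = 0.
  apply/eqP; move/eqP: e1; rewrite S0 mul0r addr0 mulf_eq0 => /orP[/eqP C0|//].
  by move/eqP: hC; rewrite C0 S0 expr0n addr0 eq_sym oner_eq0.
move: ca; rewrite -(inj_eq (mulfI b0)); apply/negP/negPn/eqP.
have -> : b * c = c * mu ^+ 2 by rewrite bE S0; ring.
rewrite cE; have -> : q ^+ 2 = 1 by rewrite -hp p0 expr0n add0r.
by rewrite mulr1 mulrC.
Qed.
End Billiard.

(** * Elliptic coordinates *)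

Section EllipticCoordinates.
Variables (R : realType) (a b : R).
Hypothesis ab : b < a.
Implicit Types p l : R * R.

Let amb_neq0 : a - b != 0. Proof. by rewrite subr_eq0 gt_eqF. Qed.

(** Clearing denominators gives one quadratic in [lam] that covers the degenerate members too: at
    [lam = b] or [lam = a] only the square of one coordinate survives. *)
Lemma on_conicE lam p : on_conic a b lam p <->
  (a - lam) * (b - lam) - p.1 ^+ 2 * (b - lam) - p.2 ^+ 2 * (a - lam) = 0.
Proof.
rewrite /on_conic; case: eqVneq => [->|lb].
  rewrite subrr !mulr0 subrr sub0r; split=> [->|/eqP].
    by rewrite expr0n mul0r oppr0.
  by rewrite oppr_eq0 mulf_eq0 (negPf amb_neq0) orbF sqrf_eq0 => /eqP.
case: eqVneq => [->|la].
  rewrite subrr !mulr0 mul0r subr0 sub0r; split=> [->|/eqP].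
    by rewrite expr0n mul0r oppr0.
  by rewrite oppr_eq0 mulf_eq0 subr_eq0 (lt_eqF ab) orbF sqrf_eq0 => /eqP.
have al : a - lam != 0 by rewrite subr_eq0 eq_sym.
have bl : b - lam != 0 by rewrite subr_eq0 eq_sym.
have -> : (a - lam) * (b - lam) - p.1 ^+ 2 * (b - lam) - p.2 ^+ 2 * (a - lam) =
  (a - lam) * (b - lam) * (1 - (p.1 ^+ 2 / (a - lam) + p.2 ^+ 2 / (b - lam))).
  by field; rewrite al bl.
split=> [->|/eqP]; first by rewrite subrr mulr0.
by rewrite mulf_eq0 (negPf (mulf_neq0 al bl)) subr_eq0 eq_sym => /eqP.
Qed.

Lemma elliptic_coords_vieta p l : elliptic_coords a b p l ->
  p.1 ^+ 2 + p.2 ^+ 2 = a + b - l.1 - l.2 /\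
  b * p.1 ^+ 2 + a * p.2 ^+ 2 = a * b - l.1 * l.2.
Proof.
case=> lt /on_conicE h1 /on_conicE h2.
have d0 : l.1 - l.2 != 0 by rewrite subr_eq0 lt_eqF.
have e : p.1 ^+ 2 + p.2 ^+ 2 = a + b - l.1 - l.2.
  apply: (mulfI d0); apply/eqP; rewrite -subr_eq0; apply/eqP.
  transitivity (((a - l.1) * (b - l.1) - p.1 ^+ 2 * (b - l.1) - p.2 ^+ 2 * (a - l.1))
   - ((a - l.2) * (b - l.2) - p.1 ^+ 2 * (b - l.2) - p.2 ^+ 2 * (a - l.2))).
    by ring.
  by rewrite h1 h2 subrr.
split=> //; apply/eqP; rewrite -subr_eq0; apply/eqP.
transitivity (l.1 * (p.1 ^+ 2 + p.2 ^+ 2 - (a + b - l.1 - l.2)) -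
  ((a - l.1) * (b - l.1) - p.1 ^+ 2 * (b - l.1) - p.2 ^+ 2 * (a - l.1))).
  by ring.
by rewrite h1 e; ring.
Qed.

Lemma squares_determined p p' :
  p.1 ^+ 2 + p.2 ^+ 2 = p'.1 ^+ 2 + p'.2 ^+ 2 ->
  b * p.1 ^+ 2 + a * p.2 ^+ 2 = b * p'.1 ^+ 2 + a * p'.2 ^+ 2 ->
  p.1 ^+ 2 = p'.1 ^+ 2 /\ p.2 ^+ 2 = p'.2 ^+ 2.
Proof.
move=> e1 e2; split; apply: (mulfI amb_neq0).
  transitivity (a * (p.1 ^+ 2 + p.2 ^+ 2) - (b * p.1 ^+ 2 + a * p.2 ^+ 2)); first by ring.
  by rewrite e1 e2; ring.
transitivity ((b * p.1 ^+ 2 + a * p.2 ^+ 2) - b * (p.1 ^+ 2 + p.2 ^+ 2)); first by ring.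
by rewrite e1 e2; ring.
Qed.

(* The discriminant below vanishes exactly at the foci. *)
Lemma elliptic_coords_or_focus p :
  (exists l, elliptic_coords a b p l) \/ p.1 ^+ 2 = a - b /\ p.2 ^+ 2 = 0.
Proof.
pose D := (p.1 ^+ 2 + p.2 ^+ 2 - (a - b)) ^+ 2 + 4 * (a - b) * p.2 ^+ 2.
have t1 : 0 <= (p.1 ^+ 2 + p.2 ^+ 2 - (a - b)) ^+ 2 by rewrite sqr_ge0.
have amb : 0 < 4 * (a - b) by rewrite mulr_gt0 // subr_gt0.
have t2 : 0 <= 4 * (a - b) * p.2 ^+ 2 by rewrite mulr_ge0 ?sqr_ge0 // ltW.
have [D0|D0] := eqVneq D 0.
  right; move/eqP: D0; rewrite /D paddr_eq0 // sqrf_eq0 subr_eq0 mulf_eq0.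
  rewrite (gt_eqF amb) /= => /andP[/eqP e1 /eqP e2].
  by split=> //; move: e1; rewrite e2 addr0.
left; have Dpos : 0 < D by rewrite lt_def D0 addr_ge0.
have s_gt0 : 0 < Num.sqrt D by rewrite sqrtr_gt0.
have s2 : Num.sqrt D ^+ 2 = D by rewrite sqr_sqrtr // ltW.
pose T := a + b - p.1 ^+ 2 - p.2 ^+ 2.
exists ((T - Num.sqrt D) / 2, (T + Num.sqrt D) / 2); split.
- by rewrite /= ltr_pM2r ?invr_gt0 // ltrD2l gtrN.
- apply/on_conicE => /=; apply: (mulfI (_ : 4 != 0)); first by rewrite pnatr_eq0.
  rewrite mulr0; transitivity (Num.sqrt D ^+ 2 - D); last by rewrite s2 subrr.
  by rewrite /D /T; field.
- apply/on_conicE => /=; apply: (mulfI (_ : 4 != 0)); first by rewrite pnatr_eq0.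
  rewrite mulr0; transitivity (Num.sqrt D ^+ 2 - D); last by rewrite s2 subrr.
  by rewrite /D /T; field.
Qed.

(** Vieta's relations give two linear equations for the squares. A point without coordinates is a
    focus, and both foci have the same squares. *)
Lemma same_elliptic_coords p p' :
  (forall l, elliptic_coords a b p l <-> elliptic_coords a b p' l) <->
  p.1 ^+ 2 = p'.1 ^+ 2 /\ p.2 ^+ 2 = p'.2 ^+ 2.
Proof.
split=> [H|[e1 e2] l]; last first.
  have E lam : on_conic a b lam p <-> on_conic a b lam p'.
    by split=> /on_conicE h; apply/on_conicE; move: h; rewrite e1 e2.
  by split=> -[? /E ? /E ?].
have [[l hl]|[e1 e2]] := elliptic_coords_or_focus p.
  have [e1 e2] := elliptic_coords_vieta hl.
  have [f1 f2] := elliptic_coords_vieta ((H l).1 hl).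
  by apply: squares_determined; rewrite ?e1 ?f1 ?e2 ?f2.
have [[l hl]|[f1 f2]] := elliptic_coords_or_focus p'; last by rewrite e1 e2 f1 f2.
have [g1 g2] := elliptic_coords_vieta hl.
have [h1 h2] := elliptic_coords_vieta ((H l).2 hl).
by apply: squares_determined; rewrite ?h1 ?g1 ?h2 ?g2.
Qed.

Lemma common_sign (x y x' y' : R) : x' ^+ 2 = x ^+ 2 -> y' ^+ 2 = y ^+ 2 ->
  x' * y' = x * y -> exists e, [/\ e ^+ 2 = 1, x' = e * x & y' = e * y].
Proof.
have signs (z z' : R) : z' ^+ 2 = z ^+ 2 -> exists2 e : R, e ^+ 2 = 1 & z' = e * z.
  move=> /eqP; rewrite eqf_sqr => /orP[] /eqP ->; [exists 1|exists (-1)];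
  by rewrite ?sqrrN ?expr1n ?mul1r ?mulN1r.
move=> /signs [e he ->] hy exy; have [x0|x0] := eqVneq x 0.
  have [f hf ->] := signs _ _ hy.
  by exists f; rewrite x0 !mulr0.
exists e; split=> //; apply: (mulfI x0).
by rewrite mulrCA -exy !mulrA -expr2 he mul1r.
Qed.

Lemma moving_point_flip v (n : nat) (e1 e2 : R) i s :
  (forall i, v (i + n%:Z) = flip e1 e2 (v i)) ->
  moving_point v (i + n%:Z) s = flip e1 e2 (moving_point v i s).
Proof.
move=> H; rewrite /moving_point addrAC !H /flip /=.
by congr (_, _); ring.
Qed.

Lemma flip_elliptic_periodic v (n : nat) (e1 e2 : R) :
  e1 ^+ 2 = 1 -> e2 ^+ 2 = 1 -> (forall i, v (i + n%:Z) = flip e1 e2 (v i)) ->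
  n_elliptic_periodic a b n v.
Proof.
move=> h1 h2 H i s _; apply/same_elliptic_coords.
by rewrite (moving_point_flip _ _ H) /flip /= !exprMn h1 h2 !mul1r.
Qed.

Lemma flip_symmetric v (n : nat) (e1 e2 : R) sigma :
  e1 ^+ 2 = 1 -> e2 ^+ 2 = 1 -> sigma =1 flip e1 e2 ->
  (forall i, v (i + n%:Z) = flip e1 e2 (v i)) -> symmetric_under sigma v.
Proof.
move=> h1 h2 sE H p; rewrite sE; split=> -[i [s [hs e]]]; exists (i + n%:Z), s.
  by rewrite e (moving_point_flip _ _ H).
by rewrite (moving_point_flip _ _ H) -e /flip /= !mulrA -!expr2 h1 h2 !mul1r; case: p {e}.
Qed.

(** The parameters 0 and 1 fix the squares of the coordinates of the two endpoints. The midpoint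
    adds the product of their abscissas and that of their ordinates, hence one sign per coordinate
    common to both. *)
Lemma elliptic_periodic_start v (n : nat) : n_elliptic_periodic a b n v ->
  exists e1 e2 : R, [/\ e1 ^+ 2 = 1, e2 ^+ 2 = 1, v n = flip e1 e2 (v 0)
    & v (n%:Z + 1) = flip e1 e2 (v 1)].
Proof.
move=> H.
have sq s : 0 <= s <= 1 -> (moving_point v n s).1 ^+ 2 = (moving_point v 0 s).1 ^+ 2
    /\ (moving_point v n s).2 ^+ 2 = (moving_point v 0 s).2 ^+ 2.
  by move=> hs; apply/same_elliptic_coords => l; have := H 0 s hs l; rewrite add0r.
have s0 : 0 <= (0 : R) <= 1 by apply/andP; split; lra.
have s1 : 0 <= (1 : R) <= 1 by apply/andP; split; lra.
have sh : 0 <= (2^-1 : R) <= 1 by apply/andP; split; lra.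
have := sq 0 s0; have := sq 1 s1; have := sq _ sh.
rewrite /moving_point /= !subrr !subr0 !mul0r !mul1r !addr0 !add0r.
move=> [hx hy] [hx1 hy1] [hx0 hy0].
have prod (x y x' y' : R) : x' ^+ 2 = x ^+ 2 -> y' ^+ 2 = y ^+ 2 ->
    ((1 - 2^-1) * x' + 2^-1 * y') ^+ 2 = ((1 - 2^-1) * x + 2^-1 * y) ^+ 2 ->
    x' * y' = x * y.
  move=> e1 e2 e; apply: (mulfI (_ : 2 != 0)); first by rewrite pnatr_eq0.
  transitivity (4 * ((1 - 2^-1) * x' + 2^-1 * y') ^+ 2 - x' ^+ 2 - y' ^+ 2); first by field.
  by rewrite e e1 e2; field.
have [e1 [h1 x0 x1]] := common_sign hx0 hx1 (prod _ _ _ _ hx0 hx1 hx).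
have [e2 [h2 y0 y1]] := common_sign hy0 hy1 (prod _ _ _ _ hy0 hy1 hy).
exists e1, e2; split=> //; rewrite /flip.
  by case: (v n) x0 y0 => ? ? /= -> ->.
by case: (v (n%:Z + 1)) x1 y1 => ? ? /= -> ->.
Qed.
End EllipticCoordinates.

(** * The orbit on the cubic *)

Section Orbit.
Variables (R : realType) (a b c : R).
Hypotheses (b_gt0 : 0 < b) (ab : b < a) (c_gt0 : 0 < c) (cb : c != b) (ca : c != a).
Variables al be ga kap : R.
Hypotheses (al_gt0 : 0 < al) (be_gt0 : 0 < be) (ga0 : ga != 0).
Hypotheses (al2 : al ^+ 2 = a) (be2 : be ^+ 2 = b) (ga2 : ga ^+ 2 = c).
Hypothesis kap2 : kap ^+ 2 = a - b.
Variable v : int -> R * R.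
Hypotheses (hv : billiard_trajectory a b v) (hcaustic : has_caustic a b c v).
Notation principal := (principal a%:C b%:C c%:C).
Local Notation I := ('i : R[i]).

Let two_neq0 : 2 != 0 :> R[i]. Proof. by rewrite pnatr_eq0. Qed.
Let eqC (x y : R) : (x%:C == y%:C) = (x == y).
Proof. by rewrite (inj_eq (@complexI R)). Qed.
Let abC : a%:C != b%:C. Proof. by rewrite eqC gt_eqF. Qed.
Let bcC : b%:C != c%:C. Proof. by rewrite eqC eq_sym. Qed.
Let acC : a%:C != c%:C. Proof. by rewrite eqC eq_sym. Qed.
Let al0 : al != 0. Proof. exact: lt0r_neq0. Qed.
Let be0 : be != 0. Proof. exact: lt0r_neq0. Qed.
Let kap0 : kap != 0.
Proof. by rewrite -sqrf_eq0 kap2 subr_eq0 gt_eqF. Qed.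
Let i0 : I != 0.
Proof. by rewrite -sqrf_eq0 sqr_i oppr_eq0 oner_neq0. Qed.

Let on_v i : on_conic a b 0 (v i). Proof. by case: (hv i). Qed.
Let v_neq i : v i != v (i + 1). Proof. by case: (hv i). Qed.
Let chord i := chord_param b_gt0 ab c_gt0 cb ca al_gt0 be_gt0 ga0 al2 be2 ga2 kap2
  (on_v i) (on_v (i + 1)) (v_neq i) (hcaustic i).

(* Square roots of a - l, l - b, l - c for the second elliptic coordinate l of
   v i; the sign of the last one records the direction of v i, v (i + 1). *)
Definition root_a i : R := kap * ((v i).1 / al).
Definition root_b i : R := kap * ((v i).2 / be).
Definition root_c i : R := ga * slope a b (v i) (v (i + 1)).

(** The half-point of the image of the vertex under the symmetry with signs [e1], [e2]. The factors
    [I] occur because b - l and c - l are minus squares of reals. *)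
Definition vertex_point (e1 e2 : R) i : R[i] * R[i] :=
  half_point a%:C (e1 * root_a i)%:C (I * (e2 * root_b i)%:C)
    (I * (e1 * e2 * root_c i)%:C).

Definition Q0 : ppoint R[i] := Some (0, (- (al * be * ga))%:C).

(* Replacing v (i + 1) by its opposite amounts to adding (c, 0), so the signs
   make the step a translation by Q0 itself. *)
Lemma vertex_point_step (e : R) (i : int) : e ^+ 2 = 1 ->
  roots_at a%:C b%:C c%:C (e * root_a i)%:C (I * (e * root_b i)%:C)
     (I * (root_c i)%:C) /\
  principal (fun Q => delta Q0 Q + delta (Some (vertex_point e e i)) Q
    - delta (Some (vertex_point (- e) (- e) (i + 1))) Q - delta None Q).
Proof.
move=> he.
have [C [S [p [q [mu [[hC hp q_gt0 hmu] [aE bE cE] [v1 v2] [w1 w2] [s1 s2]]]]]]] := chord i.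
have mu0 : mu != 0.
  apply: contraTneq q_gt0 => mu0; move/eqP: hmu; rewrite mu0 mul0r eq_sym.
  by rewrite !mulf_eq0 (negPf al0) (negPf be0) /= => /eqP ->; rewrite ltxx.
have ra : root_a i = kap * (C * p + S * q) by rewrite /root_a v1 [X in X / _]mulrC mulfK.
have rb : root_b i = kap * (S * p - C * q) by rewrite /root_b v2 [X in X / _]mulrC mulfK.
have ra' : root_a (i + 1) = kap * (C * p - S * q).
  by rewrite /root_a w1 [X in X / _]mulrC mulfK.
have rb' : root_b (i + 1) = kap * (S * p + C * q).
  by rewrite /root_b w2 [X in X / _]mulrC mulfK.
have rc' : root_c (i + 1) = - (mu * p + kap ^+ 2 * S * C * q / mu).
  by rewrite /root_c (slope_next b_gt0 ab hv) mulrN s2.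
have y0E : - (al * be * ga) * mu = - (a * b * q).
  transitivity (- (al * be * (mu * ga))); first by ring.
  by rewrite hmu -al2 -be2; ring.
(* The sign [e] is absorbed into [C] and [S]; the third roots contain only their product, which does
   not change. *)
have [||||||||||||||h1 h2] := @principal_chord_step R[i] a%:C b%:C c%:C two_neq0 abC bcC acC
  I kap%:C mu%:C (e * C)%:C (e * S)%:C p%:C q%:C (- (al * be * ga))%:C
  (e * root_a i)%:C (I * (e * root_b i)%:C) (I * (root_c i)%:C)
  (- e * root_a (i + 1))%:C (I * (- e * root_b (i + 1))%:C) (I * (root_c (i + 1))%:C).
- exact: sqr_i.
- by rewrite -!rmorphXn -rmorphD !exprMn he !mul1r hC rmorph1.
- by rewrite -!rmorphXn -rmorphD hp rmorph1.
- by rewrite eqC.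
- by rewrite -!rmorphXn -rmorphM -rmorphD exprMn he mul1r -aE.
- by rewrite -!rmorphXn -rmorphM -rmorphB exprMn he mul1r -bE.
- by rewrite -!rmorphXn -!rmorphM cE.
- by rewrite -!rmorphM -rmorphN y0E.
- by rewrite ra -!rmorphM -rmorphD -rmorphM; congr (_%:C); ring.
- by rewrite rb -!rmorphM -rmorphB -rmorphM; congr (_ * _%:C); ring.
- rewrite [root_c i]s1 [RHS]mulNr -mulrN -fmorphV -!rmorphXn -!rmorphM -rmorphB -rmorphN.
  congr (_ * _%:C); transitivity (- (mu * p) + kap ^+ 2 * S * C * q / mu * e ^+ 2).
    by rewrite he mulr1.
  by ring.
- by rewrite ra' [RHS]mulNr -!rmorphM -rmorphB -rmorphM -rmorphN; congr (_%:C); ring.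
- by rewrite rb' [RHS]mulNr -mulrN -!rmorphM -rmorphD -rmorphM -rmorphN; congr (_ * _%:C); ring.
- rewrite rc' [RHS]mulNr -mulrN -fmorphV -!rmorphXn -!rmorphM -rmorphD -rmorphN.
  congr (_ * _%:C); transitivity (- (mu * p + kap ^+ 2 * S * C * q / mu * e ^+ 2)).
    by rewrite he mulr1.
  by ring.
split; first exact: h1.
rewrite /vertex_point /Q0.
by rewrite mulrNN -expr2 he !mul1r.
Qed.

Lemma vertex_roots (e1 e2 : R) i : e1 ^+ 2 = 1 -> e2 ^+ 2 = 1 ->
  roots_at a%:C b%:C c%:C (e1 * root_a i)%:C (I * (e2 * root_b i)%:C)
    (I * (e1 * e2 * root_c i)%:C).
Proof.
move=> h1 h2; have [h _] := vertex_point_step i (expr1n _ 2).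
apply: roots_at_opp h _ _ _.
- by rewrite -!rmorphXn !exprMn h1 expr1n.
- by rewrite exprMn [RHS]exprMn -!rmorphXn !exprMn h2 expr1n.
- by rewrite exprMn [RHS]exprMn -!rmorphXn !exprMn h1 h2 !mul1r.
Qed.

Lemma vertex_on_curve (e1 e2 : R) i : e1 ^+ 2 = 1 -> e2 ^+ 2 = 1 ->
  (vertex_point e1 e2 i).2 ^+ 2 =
  cubic_at a%:C b%:C c%:C (vertex_point e1 e2 i).1.
Proof. by move=> h1 h2; apply/half_point_on_curve/vertex_roots. Qed.

Lemma vertex_point_eq (e e1 e2 : R) (n : nat) :
  e ^+ 2 = 1 -> e1 ^+ 2 = 1 -> e2 ^+ 2 = 1 ->
  vertex_point e e n = vertex_point (e * e1) (e * e2) 0 <->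
  forall i, v (i + n%:Z) = flip e1 e2 (v i).
Proof.
move=> h h1 h2.
have e0 : e != 0 by rewrite -sqrf_eq0 h oner_eq0.
have ee : e * e = 1 by rewrite -expr2.
have he1 : (e * e1) ^+ 2 = 1 by rewrite exprMn h h1 mul1r.
have he2 : (e * e2) ^+ 2 = 1 by rewrite exprMn h h2 mul1r.
have c1 : e * e1 * (e * e2) = e1 * e2 by rewrite mulrACA ee mul1r.
split=> [E|H].
  have [E1 E2 E3] := half_point_inj two_neq0 abC bcC acC
    (vertex_roots n h h) (vertex_roots 0 he1 he2) E.
  have F1 := complexI E1; have F2 := complexI (mulfI i0 E2).
  have F3 := complexI (mulfI i0 E3).
  rewrite ee c1 mul1r in F3.
  apply: (trajectory_flip b_gt0 ab hv h1 h2).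
    rewrite -!mulrA in F1 F2.
    have G1 : (v n).1 = e1 * (v 0).1.
      have := mulfI e0 F1; rewrite /root_a [RHS]mulrCA => /(mulfI kap0).
      by rewrite mulrA => /(mulIf (invr_neq0 al0)).
    have G2 : (v n).2 = e2 * (v 0).2.
      have := mulfI e0 F2; rewrite /root_b [RHS]mulrCA => /(mulfI kap0).
      by rewrite mulrA => /(mulIf (invr_neq0 be0)).
    by rewrite /flip -G1 -G2; case: (v n).
  by move: F3; rewrite /root_c add0r [RHS]mulrCA => /(mulfI ga0).
have H0 : v n = flip e1 e2 (v 0) by rewrite -H add0r.
have H1 : v (n%:Z + 1) = flip e1 e2 (v 1) by rewrite -H addrC.
rewrite /vertex_point c1 ee mul1r /root_a /root_b /root_c H1 H0 add0r.
rewrite slope_flip // /flip /=; congr half_point.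
- by congr (_%:C); ring.
- by congr (_ * _%:C); ring.
- by congr (_ * _%:C); ring.
Qed.

Lemma vertex_point_chain (n : nat) :
  principal (fun P => n%:Z * (delta Q0 P - delta None P)
    + delta (Some (vertex_point 1 1 0)) P
    - delta (Some (vertex_point ((-1) ^+ n) ((-1) ^+ n) n)) P).
Proof.
elim: n => [|n IH].
  by apply: eq_principal (principal0 _ _ _) => P; rewrite expr0; ring.
have [_ h] := vertex_point_step n (sqrr_sign R n).
apply: eq_principal (principalD IH h) => P.
by rewrite exprS mulN1r -[n.+1]addn1 PoszD; ring.
Qed.

(** Subtracting [vertex_point_chain] leaves the difference of two half-points, which coincide by
    [principal_inj]. *)
Lemma principal_period (e1 e2 : R) (n : nat) : e1 ^+ 2 = 1 -> e2 ^+ 2 = 1 ->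
  principal (fun P => n%:Z * (delta Q0 P - delta None P)
    + delta (Some (vertex_point 1 1 0)) P
    - delta (Some (vertex_point ((-1) ^+ n * e1) ((-1) ^+ n * e2) 0)) P) <->
  forall i, v (i + n%:Z) = flip e1 e2 (v i).
Proof.
move=> h1 h2; rewrite -(vertex_point_eq n (sqrr_sign R n) h1 h2).
split=> [h|<-]; last exact: vertex_point_chain.
have hs := sqrr_sign R n.
have hs1 : ((-1) ^+ n * e1) ^+ 2 = 1 :> R by rewrite exprMn hs h1 mul1r.
have hs2 : ((-1) ^+ n * e2) ^+ 2 = 1 :> R by rewrite exprMn hs h2 mul1r.
have := vertex_on_curve 0 hs1 hs2; have := vertex_on_curve n hs hs.
have : principal (fun P =>
    delta (Some (vertex_point ((-1) ^+ n) ((-1) ^+ n) n)) P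
    - delta (Some (vertex_point ((-1) ^+ n * e1) ((-1) ^+ n * e2) 0)) P).
  apply: eq_principal (principalD h (principalN (vertex_point_chain n))) => P; ring.
case: (vertex_point _ _ n) (vertex_point _ _ 0) => [x1 y1] [x2 y2] /= hp hc1 hc2.
by have [-> ->] := principal_inj two_neq0 abC bcC acC hc1 hc2 hp.
Qed.

(** After correction by [(-1) ^+ n], the sign pairs that matter are (1, 1), (-1, -1) and (-1, 1),
    the translations by zero, (c, 0) and (b, 0). *)
Lemma principal_period0 (e1 e2 : R) (n : nat) : e1 ^+ 2 = 1 -> e2 ^+ 2 = 1 ->
  (-1) ^+ n * e1 = 1 -> (-1) ^+ n * e2 = 1 ->
  principal (fun P => n%:Z * (delta Q0 P - delta None P)) <->
  forall i, v (i + n%:Z) = flip e1 e2 (v i).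
Proof.
move=> h1 h2 k1 k2; rewrite -(principal_period n h1 h2) k1 k2.
by split; apply: eq_principal => P; ring.
Qed.

Lemma principal_period_c (e1 e2 : R) (n : nat) : e1 ^+ 2 = 1 -> e2 ^+ 2 = 1 ->
  (-1) ^+ n * e1 = -1 -> (-1) ^+ n * e2 = -1 ->
  principal (fun P => n%:Z * (delta Q0 P - delta None P)
    + delta None P - delta (Some (c%:C, 0)) P) <->
  forall i, v (i + n%:Z) = flip e1 e2 (v i).
Proof.
move=> h1 h2 k1 k2; rewrite -(principal_period n h1 h2) k1 k2.
have h := vertex_roots 0 (expr1n R 2) (expr1n R 2).
have hp := principal_add_c two_neq0 abC bcC acC h.
have <- : half_point a%:C (- (1 * root_a 0)%:C) (- (I * (1 * root_b 0)%:C))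
    (I * (1 * 1 * root_c 0)%:C) = vertex_point (-1) (-1) 0.
  by rewrite -mulrN -!rmorphN; congr half_point; congr (_ * _%:C) || congr (_%:C); ring.
by rewrite -(principal_sum _ hp); split; apply: eq_principal => P; rewrite /vertex_point; ring.
Qed.

Lemma principal_period_b (e1 e2 : R) (n : nat) : e1 ^+ 2 = 1 -> e2 ^+ 2 = 1 ->
  (-1) ^+ n * e1 = -1 -> (-1) ^+ n * e2 = 1 ->
  principal (fun P => n%:Z * (delta Q0 P - delta None P)
    + delta None P - delta (Some (b%:C, 0)) P) <->
  forall i, v (i + n%:Z) = flip e1 e2 (v i).
Proof.
move=> h1 h2 k1 k2; rewrite -(principal_period n h1 h2) k1 k2.
have h := vertex_roots 0 (expr1n R 2) (expr1n R 2).
have hp := principal_add_b two_neq0 abC bcC acC h.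
have <- : half_point a%:C (- (1 * root_a 0)%:C) (I * (1 * root_b 0)%:C)
    (- (I * (1 * 1 * root_c 0)%:C)) = vertex_point (-1) 1 0.
  by rewrite -mulrN -!rmorphN; congr half_point; congr (_ * _%:C) || congr (_%:C); ring.
by rewrite -(principal_sum _ hp); split; apply: eq_principal => P; rewrite /vertex_point; ring.
Qed.

(** * From translations to the conditions on divisors *)

Let T x : ppoint R[i] := Some (x%:C, 0).

Lemma nat_parity n : n%:Z = 2 * n./2%:Z + (odd n)%:Z.
Proof. by rewrite -PoszM -PoszD -{1}(odd_double_half n) addnC -mul2n. Qed.

(** With O at infinity, 2 T ~ 2 O for each point of order two and T a + T b + T c ~ 3 O give T b - T
    a ~ O - T c. Reducing n T c modulo 2 T c ~ 2 O leaves n (Q0 - O), plus O - T c exactly when [n]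
    is even; both parities mean the central symmetry. *)
Lemma criterion_a n :
  principal (fun P => n%:Z * (delta Q0 P - delta (T c) P)
    + delta (T b) P - delta (T a) P) <->
  forall i, v (i + n%:Z) = flip (-1) (-1) (v i).
Proof.
have [t3 ta tb tc] := principal_torsion two_neq0 abC bcC acC.
have m2 : (-1) ^+ 2 = 1 :> R by rewrite sqrrN expr1n.
have sE : (-1) ^+ n = (-1) ^+ odd n :> R by rewrite signr_odd.
have nE := nat_parity n; have tch := principalN (principalMn n./2 tc).
have s0 := principalD tch (principalD t3 (principalN ta)).
case: (odd n) sE nE => /= sE nE.
  rewrite -principal_period0 // ?sE ?mulrNN ?mulr1 //.
  rewrite -(principal_sum _ (principalD s0 (principalN tc))).
  by split; apply: eq_principal => P; rewrite nE /T; ring.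
rewrite -principal_period_c // ?sE ?mul1r //.
rewrite -[in X in _ <-> X](principal_sum _ s0).
by split; apply: eq_principal => P; rewrite nE /T; ring.
Qed.

(** Here T c - T a ~ O - T b. For odd [n] it joins the unpaired O - T b and cancels; for even [n] it
    remains and gives the translation by (b, 0). *)
Lemma criterion_b_odd n : odd n ->
  principal (fun P => n%:Z * (delta Q0 P - delta (T b) P)
    + delta (T c) P - delta (T a) P) <->
  forall i, v (i + n%:Z) = flip (-1) (-1) (v i).
Proof.
move=> on; have [t3 ta tb tc] := principal_torsion two_neq0 abC bcC acC.
have m2 : (-1) ^+ 2 = 1 :> R by rewrite sqrrN expr1n.
have sE : (-1) ^+ n = -1 :> R by rewrite -signr_odd on.
have nE := nat_parity n; rewrite on /= in nE.
have s0 := principalD (principalN (principalMn n./2 tb)) (principalD t3 (principalN ta)).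
rewrite -principal_period0 // ?sE ?mulrNN ?mulr1 //.
rewrite -[in X in _ <-> X](principal_sum _ (principalD s0 (principalN tb))).
by split; apply: eq_principal => P; rewrite nE /T; ring.
Qed.

Lemma criterion_b_even n : ~~ odd n ->
  principal (fun P => n%:Z * (delta Q0 P - delta (T b) P)
    + delta (T c) P - delta (T a) P) <->
  forall i, v (i + n%:Z) = flip (-1) 1 (v i).
Proof.
move=> en; have [t3 ta tb tc] := principal_torsion two_neq0 abC bcC acC.
have m2 : (-1) ^+ 2 = 1 :> R by rewrite sqrrN expr1n.
have sE : (-1) ^+ n = 1 :> R by rewrite -signr_odd (negPf en).
have nE := nat_parity n; rewrite (negPf en) /= in nE.
have s0 := principalD (principalN (principalMn n./2 tb)) (principalD t3 (principalN ta)).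
rewrite -principal_period_b // ?sE ?mul1r ?expr1n //.
rewrite -[in X in _ <-> X](principal_sum _ s0).
by split; apply: eq_principal => P; rewrite nE /T; ring.
Qed.

Lemma criterion_c n : odd n ->
  principal (fun P => n%:Z * (delta Q0 P - delta (T b) P)) <->
  forall i, v (i + n%:Z) = flip 1 (-1) (v i).
Proof.
move=> on; have [t3 ta tb tc] := principal_torsion two_neq0 abC bcC acC.
have m2 : (-1) ^+ 2 = 1 :> R by rewrite sqrrN expr1n.
have sE : (-1) ^+ n = -1 :> R by rewrite -signr_odd on.
have nE := nat_parity n; rewrite on /= in nE.
rewrite -principal_period_b // ?sE ?mulrNN ?mulr1 ?expr1n //.
rewrite -[in X in _ <-> X](principal_sum _ (principalN (principalMn n./2 tb))).
by split; apply: eq_principal => P; rewrite nE /T; ring.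
Qed.

(** * Sign constraints imposed by the type of caustic *)

Let tau i := slope a b (v i) (v (i + 1)).

Lemma slope_sign (n : nat) : c < b -> 0 < tau 0 * tau n.
Proof.
move=> cltb.
have next i : 0 < tau i * tau (i + 1).
  rewrite /tau (slope_next b_gt0 ab hv).
  exact: (slope_same_side b_gt0 ab c_gt0 cb ca al_gt0 be_gt0 ga0 al2 be2 ga2 kap2).
have nz i : tau i != 0.
  by apply: contraTneq (next i) => ->; rewrite mul0r ltxx.
elim: n => [|n IH]; first by rewrite -expr2 exprn_even_gt0 //; exact: nz.
have := mulr_gt0 IH (next n); rewrite mulrA -(mulrA (tau 0)) -expr2 mulrAC.
rewrite -[n.+1]addn1 PoszD pmulr_lgt0 // exprn_even_gt0 //; exact: nz.
Qed.

Lemma ordinate_sign (n : nat) : b < c -> 0 < (-1) ^+ n * ((v 0).2 * (v n).2).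
Proof.
move=> bltc.
have next i : (v i).2 * (v (i + 1)).2 < 0.
  exact: (opposite_sides b_gt0 ab c_gt0 cb ca al_gt0 be_gt0 ga0 al2 be2 ga2 kap2).
have nz i : (v i).2 != 0.
  by apply: contraTneq (next i) => ->; rewrite mul0r ltxx.
elim: n => [|n IH]; first by rewrite expr0 mul1r -expr2 exprn_even_gt0 //; exact: nz.
have sq : 0 < (v n).2 ^+ 2 by rewrite exprn_even_gt0 //; exact: nz.
have := next n; rewrite -oppr_gt0 => /(mulr_gt0 IH) h.
rewrite -(pmulr_rgt0 _ sq) -[n.+1]addn1 PoszD addn1.
have -> : (v n).2 ^+ 2 * ((-1) ^+ n.+1 * ((v 0).2 * (v (n%:Z + 1)).2)) =
  (-1) ^+ n * ((v 0).2 * (v n).2) * - ((v n).2 * (v (n%:Z + 1)).2).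
  by rewrite (exprS _ n); ring.
exact: h.
Qed.

Lemma flip_slope (e1 e2 : R) (n : nat) : e1 ^+ 2 = 1 -> e2 ^+ 2 = 1 ->
  (forall i, v (i + n%:Z) = flip e1 e2 (v i)) -> c < b -> e1 * e2 = 1.
Proof.
move=> h1 h2 H cltb.
have h12 : (e1 * e2) ^+ 2 == 1 ^+ 2 by rewrite exprMn h1 h2 mul1r expr1n.
move: h12; rewrite eqf_sqr => /orP[/eqP //|/eqP e12].
have E0 : v n = flip e1 e2 (v 0) by rewrite -H add0r.
have E1 : v (n%:Z + 1) = flip e1 e2 (v 1) by rewrite -H addrC.
have := slope_sign n cltb; rewrite /tau E0 E1 add0r slope_flip // e12.
by rewrite mulN1r mulrN -expr2 oppr_gt0 ltNge sqr_ge0.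
Qed.

Lemma flip_ordinate (e1 e2 : R) (n : nat) : e2 ^+ 2 = 1 ->
  (forall i, v (i + n%:Z) = flip e1 e2 (v i)) -> b < c -> e2 = (-1) ^+ n.
Proof.
move=> h2 H bltc; have E0 : v n = flip e1 e2 (v 0) by rewrite -H add0r.
have := ordinate_sign n bltc; rewrite E0 /=.
have : e2 ^+ 2 == ((-1) ^+ n) ^+ 2 by rewrite sqrr_sign h2.
rewrite eqf_sqr => /orP[/eqP //|/eqP ->].
set s := (-1) ^+ n.
have -> : s * ((v 0).2 * (- s * (v 0).2)) = - (s * (v 0).2) ^+ 2 by ring.
by rewrite oppr_gt0 ltNge sqr_ge0.
Qed.

Lemma elliptic_periodic_flip (n : nat) : n_elliptic_periodic a b n v ->
  exists e1 e2 : R, [/\ e1 ^+ 2 = 1, e2 ^+ 2 = 1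
    & forall i, v (i + n%:Z) = flip e1 e2 (v i)].
Proof.
move=> /(elliptic_periodic_start ab) [e1 [e2 [h1 h2 e0 e3]]].
exists e1, e2; split=> //; apply: (trajectory_flip b_gt0 ab hv h1 h2 e0).
by rewrite e0 e3 slope_flip.
Qed.

(** A nontrivial symmetry might still fix every vertex. With [e1 = -1] two consecutive vertices
    would lie on the y-axis, against [not_vertical]; with [e2 = -1] a vertex would lie on the
    x-axis, against [ordinate_sign]. *)
Lemma flip_not_periodic (e1 e2 : R) (n : nat) :
  (forall i, v (i + n%:Z) = flip e1 e2 (v i)) ->
  e1 = -1 \/ e2 = -1 /\ b < c -> ~ n_periodic n v.
Proof.
move=> H cond P.
have E i : v i = flip e1 e2 (v i) by rewrite -H P.
have opp (x : R) : x = -1 * x -> x = 0.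
  by move=> e; lra.
have ver : e1 = -1 -> False.
  move=> e1E; have x0 i : (v i).1 = 0 by apply: opp; rewrite -e1E {1}E.
  exact: (not_vertical b_gt0 ab c_gt0 cb ca al_gt0 be_gt0 ga0 al2 be2 ga2 kap2
    (on_v 0) (on_v (0 + 1)) (v_neq 0) (hcaustic 0)).
case: cond => [//|[e2E bltc]].
have y0 : (v 0).2 = 0 by apply: opp; rewrite -e2E {1}E.
by have := ordinate_sign n bltc; rewrite y0 mul0r mulr0 ltxx.
Qed.
End Orbit.

Theorem theorem2p7 (R : realType) (a b lam0 : R) (n : nat)
    (hb : 0 < b) (hab : b < a)
    (hlam0 : 0 < lam0 < b \/ b < lam0 < a)
    (hn : (0 < n)%N)
    (Q0 Qa Qb Qlam0 : ppoint R[i])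
    (hQ0 : curve_point_over a%:C b%:C lam0%:C 0 Q0)
    (hQa : curve_point_over a%:C b%:C lam0%:C a%:C Qa)
    (hQb : curve_point_over a%:C b%:C lam0%:C b%:C Qb)
    (hQlam0 : curve_point_over a%:C b%:C lam0%:C lam0%:C Qlam0)
    (v : int -> R * R)
    (hv : billiard_trajectory a b v)
    (hcaustic : has_caustic a b lam0 v) :
  let sim := linear_equiv a%:C b%:C lam0%:C in
  let case_a :=
    is_ellipse b lam0 /\
    sim ((dpoint Q0 - dpoint Qlam0) *+ n + dpoint Qb - dpoint Qa) 0 in
  let case_b :=
    is_hyperbola a b lam0 /\
    sim ((dpoint Q0 - dpoint Qb) *+ n + dpoint Qlam0 - dpoint Qa) 0 in
  let case_c :=
    [/\ is_hyperbola a b lam0, odd n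
      & sim ((dpoint Q0 - dpoint Qb) *+ n) 0] in
  let elliptic_not_periodic :=
    n_elliptic_periodic a b n v /\ ~ n_periodic n v in
  [/\ elliptic_not_periodic <-> [\/ case_a, case_b | case_c],
      elliptic_not_periodic -> case_a ->
        symmetric_under (@central_sym R) v,
      elliptic_not_periodic -> case_b -> odd n ->
        symmetric_under (@central_sym R) v,
      elliptic_not_periodic -> case_b -> ~~ odd n ->
        symmetric_under (@y_axis_sym R) v
    & elliptic_not_periodic -> case_c ->
        symmetric_under (@x_axis_sym R) v].
Proof.
move=> sim case_a case_b case_c enp.
have a_gt0 : 0 < a by apply: lt_trans hab.
have c_gt0 : 0 < lam0.
  by case: hlam0 => /andP[h _] //; apply: lt_trans h.
have cb : lam0 != b.
  by case: hlam0 => /andP[h1 h2]; [rewrite lt_eqF|rewrite gt_eqF].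
have ca : lam0 != a.
  case: hlam0 => /andP[h1 h2]; rewrite lt_eqF //; exact: lt_trans hab.
pose al := Num.sqrt a; pose be := Num.sqrt b; pose kap := Num.sqrt (a - b).
have al_gt0 : 0 < al by rewrite sqrtr_gt0.
have be_gt0 : 0 < be by rewrite sqrtr_gt0.
have al2 : al ^+ 2 = a by rewrite sqr_sqrtr // ltW.
have be2 : be ^+ 2 = b by rewrite sqr_sqrtr // ltW.
have kap2 : kap ^+ 2 = a - b by rewrite sqr_sqrtr // subr_ge0 ltW.
have torsion x Q : cubic_at a%:C b%:C lam0%:C x%:C = 0 ->
    curve_point_over a%:C b%:C lam0%:C x%:C Q -> Q = Some (x%:C, 0).
  move=> f0 [on [y QE]]; move: on; rewrite QE => /on_curve_affine /eqP.
  by rewrite f0 sqrf_eq0 => /eqP ->.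
have QaE : Qa = Some (a%:C, 0) by apply: torsion hQa; rewrite /cubic_at subrr !mul0r.
have QbE : Qb = Some (b%:C, 0).
  by apply: torsion hQb; rewrite /cubic_at subrr mulr0 mul0r.
have QcE : Qlam0 = Some (lam0%:C, 0).
  by apply: torsion hQlam0; rewrite /cubic_at subrr mulr0.
(* Either of the two points over 0 may be given, so [ga] is the square root of [lam0] whose sign
   fits [Q0]. *)
have [ga [ga0 ga2 Q0E]] : exists ga : R, [/\ ga != 0, ga ^+ 2 = lam0
    & Q0 = Some (0, (- (al * be * ga))%:C)].
  have g_gt0 : 0 < Num.sqrt lam0 by rewrite sqrtr_gt0.
  have g2 : Num.sqrt lam0 ^+ 2 = lam0 by rewrite sqr_sqrtr // ltW.
  have [on [y QE]] := hQ0; move: on; rewrite QE => /on_curve_affine hy.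
  have : y ^+ 2 == ((al * be * Num.sqrt lam0)%:C) ^+ 2.
    by rewrite hy /cubic_at !subr0 -!rmorphM -rmorphXn !exprMn al2 be2 g2.
  rewrite eqf_sqr => /orP[] /eqP ->.
    exists (- Num.sqrt lam0); rewrite oppr_eq0 sqrrN gt_eqF //.
    by rewrite mulrN opprK.
  by exists (Num.sqrt lam0); rewrite gt_eqF // rmorphN.
have m2 : (-1) ^+ 2 = 1 :> R by rewrite sqrrN expr1n.
have o2 : 1 ^+ 2 = 1 :> R by rewrite expr1n.
have to_flip := elliptic_periodic_flip hb hab hv.
have of_flip e1 e2 (h1 : e1 ^+ 2 = 1) (h2 : e2 ^+ 2 = 1) H :=
  flip_elliptic_periodic hab h1 h2 (H : forall i, v (i + n%:Z) = flip e1 e2 (v i)).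
have np := flip_not_periodic hb hab c_gt0 cb ca al_gt0 be_gt0 ga0 al2 be2 ga2 kap2
  hv hcaustic.
have same_side := flip_slope hb hab c_gt0 cb ca al_gt0 be_gt0 ga0 al2 be2 ga2 kap2
  hv hcaustic.
have alternate := flip_ordinate hb hab c_gt0 cb ca al_gt0 be_gt0 ga0 al2 be2 ga2 kap2
  hv hcaustic.
have simE D phi : (forall P, coeff P D = phi P) ->
    sim D 0 <-> principal a%:C b%:C lam0%:C phi.
  by move=> DE; rewrite /sim linear_equiv0; split; apply: eq_principal.
have sim_a : sim ((dpoint Q0 - dpoint Qlam0) *+ n + dpoint Qb - dpoint Qa) 0 <->
    forall i, v (i + n%:Z) = flip (-1) (-1) (v i).
  rewrite -(criterion_a hb hab c_gt0 cb ca al_gt0 be_gt0 ga0 al2 be2 ga2 kap2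
    hv hcaustic n); apply: simE => P.
  rewrite coeffB coeffD coeffMn coeffB !coeff_dpoint QaE QbE QcE Q0E.
  by rewrite -mulr_natl natz.
have coef_b P : coeff P ((dpoint Q0 - dpoint Qb) *+ n + dpoint Qlam0 - dpoint Qa) =
   n%:Z * (delta (Some (0, (- (al * be * ga))%:C)) P - delta (Some (b%:C, 0)) P)
    + delta (Some (lam0%:C, 0)) P - delta (Some (a%:C, 0)) P.
  rewrite coeffB coeffD coeffMn coeffB !coeff_dpoint QaE QbE QcE Q0E.
  by rewrite -mulr_natl natz.
have sim_bo : odd n ->
    sim ((dpoint Q0 - dpoint Qb) *+ n + dpoint Qlam0 - dpoint Qa) 0 <->
    forall i, v (i + n%:Z) = flip (-1) (-1) (v i).
  move=> on; rewrite (simE _ _ coef_b).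
  exact: (criterion_b_odd hb hab c_gt0 cb ca al_gt0 be_gt0 ga0 al2 be2 ga2 kap2
    hv hcaustic on).
have sim_be : ~~ odd n ->
    sim ((dpoint Q0 - dpoint Qb) *+ n + dpoint Qlam0 - dpoint Qa) 0 <->
    forall i, v (i + n%:Z) = flip (-1) 1 (v i).
  move=> en; rewrite (simE _ _ coef_b).
  exact: (criterion_b_even hb hab c_gt0 cb ca al_gt0 be_gt0 ga0 al2 be2 ga2 kap2
    hv hcaustic en).
have sim_c : odd n -> sim ((dpoint Q0 - dpoint Qb) *+ n) 0 <->
    forall i, v (i + n%:Z) = flip 1 (-1) (v i).
  move=> on; rewrite -(criterion_c hb hab c_gt0 cb ca al_gt0 be_gt0 ga0 al2 be2 ga2 kap2
    hv hcaustic on); apply: simE => P.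
  rewrite coeffMn coeffB !coeff_dpoint QbE Q0E.
  by rewrite -mulr_natl natz.
have sgn (e : R) : e ^+ 2 = 1 -> e = 1 \/ e = -1.
  by move=> /eqP; rewrite -{1}o2 eqf_sqr => /orP[] /eqP ->; [left|right].
have m1 : (1 : R) <> -1 by move=> e; lra.
split.
- split=> [[ep nper]|].
    have [e1 [e2 [h1 h2 H]]] := to_flip n ep.
    have no_id : e1 = 1 -> e2 = 1 -> False.
      move=> e1E e2E; apply: nper => i; rewrite H e1E e2E /flip !mul1r.
      by case: (v i).
    case: hlam0 => /andP[hl1 hl2].
      (* Of the two sign pairs with product 1, non-periodicity excludes the identity. *)
      have e12 := same_side e1 e2 n h1 h2 H hl2.
      have [e1E e2E] : e1 = -1 /\ e2 = -1.
        case: (sgn _ h1) (sgn _ h2) => e1E [] e2E //.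
        - by case: no_id.
        - by case: m1; move: e12; rewrite e1E e2E ?mul1r ?mulr1 => ->.
        - by case: m1; move: e12; rewrite e1E e2E ?mul1r ?mulr1 => ->.
      rewrite e1E e2E in H.
      by constructor 1; split=> //; apply/sim_a.
    have hyp : is_hyperbola a b lam0 by rewrite /is_hyperbola hl1.
    have e2E := alternate e1 e2 n h2 H hl1.
    (* For odd [n] both values of [e1] survive and give (c) and (b); for even [n] the value [e1 = 1]
       would be the identity, and only (b) remains. *)
    have [on|en] := boolP (odd n).
      have {}e2E : e2 = -1 by rewrite e2E -signr_odd on.
      case: (sgn _ h1) => e1E; rewrite e1E e2E in H.
        by constructor 3; split=> //; apply/(sim_c on).
      by constructor 2; split=> //; apply/(sim_bo on).
    have {}e2E : e2 = 1 by rewrite e2E -signr_odd (negPf en).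
    case: (sgn _ h1) => e1E; first by case: no_id.
    rewrite e1E e2E in H.
    by constructor 2; split=> //; apply/(sim_be en).
  case.
  - case=> _ /sim_a H; split; first exact: of_flip H.
    by apply: np H _; left.
  - case=> /andP[hl1 hl2]; have [on|en] := boolP (odd n).
      move=> /(sim_bo on) H; split; first exact: of_flip H.
      by apply: np H _; left.
    move=> /(sim_be en) H; split; first exact: of_flip H.
    by apply: np H _; left.
  - case=> /andP[hl1 hl2] on /(sim_c on) H; split; first exact: of_flip H.
    by apply: np H _; right.
- move=> _ [_ /sim_a H]; apply: flip_symmetric H => // p.
  by rewrite /central_sym /flip !mulN1r.
- move=> _ [_ hs] on; apply: flip_symmetric ((sim_bo on).1 hs) => // p.
  by rewrite /central_sym /flip !mulN1r.
- move=> _ [_ hs] en; apply: flip_symmetric ((sim_be en).1 hs) => // p.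
  by rewrite /y_axis_sym /flip mulN1r mul1r.
- move=> _ [_ on hs]; apply: flip_symmetric ((sim_c on).1 hs) => // p.
  by rewrite /x_axis_sym /flip mulN1r mul1r.
Qed.
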